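(* Let $0<q\le\infty$. For each of the ranges of $p$ below there is a constant $C>0$, independent of $f$, such that for every martingale $f\in\mathcal{M}$ (inequalities being understood in $[0,\infty]$): (i) $\|f\|_{H^*_{p,q}(\mathbb{R})}\le C\|f\|_{H^s_{p,q}(\mathbb{R})}$ and $\|f\|_{H^S_{p,q}(\mathbb{R})}\le C\|f\|_{H^s_{p,q}(\mathbb{R})}$, for $0<p\le 2$; (ii) $\|f\|_{H^s_{p,q}(\mathbb{R})}\le C\|f\|_{H^*_{p,q}(\mathbb{R})}$ and $\|f\|_{H^s_{p,q}(\mathbb{R})}\le C\|f\|_{H^S_{p,q}(\mathbb{R})}$, for $2\le p<\infty$; (iii) $\|f\|_{H^*_{p,q}(\mathbb{R})}\le C\|f\|_{\mathcal{P}_{p,q}(\mathbb{R})}$ and $\|f\|_{H^S_{p,q}(\mathbb{R})}\le C\|f\|_{\mathcal{Q}_{p,q}(\mathbb{R})}$, for $0<p<\infty$; (iv) $\|f\|_{H^*_{p,q}(\mathbb{R})}\le C\|f\|_{\mathcal{Q}_{p,q}(\mathbb{R})}$ and $\|f\|_{H^S_{p,q}(\mathbb{R})}\le C\|f\|_{\mathcal{P}_{p,q}(\mathbb{R})}$, for $0<p<\infty$; (v) $\|f\|_{H^s_{p,q}(\mathbb{R})}\le C\|f\|_{\mathcal{P}_{p,q}(\mathbb{R})}$ and $\|f\|_{H^s_{p,q}(\mathbb{R})}\le C\|f\|_{\mathcal{Q}_{p,q}(\mathbb{R})}$, for $0<p<\infty$. Moreover, if the filtration $(\mathcal{F}_n)_{n\ge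 0}$ is regular, then for $0<p<\infty$ the five spaces $H^S_{p,q}(\mathbb{R})$, $H^s_{p,q}(\mathbb{R})$, $H^*_{p,q}(\mathbb{R})$, $\mathcal{Q}_{p,q}(\mathbb{R})$ and $\mathcal{P}_{p,q}(\mathbb{R})$ are all equivalent, i.e. they coincide as sets with equivalent (quasi-)norms.
   Context: Setting: for $n\in\mathbb{N}=\{0,1,2,\dots\}$, $\mathcal{F}_n$ is the $\sigma$-algebra on $\mathbb{R}$ generated by the dyadic intervals $[k2^{-n},(k+1)2^{-n})$, $k\in\mathbb{Z}$; $\mathcal{F}$ is the $\sigma$-algebra generated by $\bigcup_n\mathcal{F}_n$; $\mathbb{P}$ is a probability measure on $(\mathbb{R},\mathcal{F})$; $\mathbb{E}$ and $\mathbb{E}_n$ are expectation and conditional expectation given $\mathcal{F}_n$. Put $A_j=[j,j+1)$, $j\in\mathbb{Z}$. $\mathcal{M}$ is the set of all martingales $f=(f_n)_{n\ge0}$ with respect to $(\mathcal{F}_n)$, with the convention $f_0=0$; $d_nf=f_n-f_{n-1}$ for $n\ge1$ and $d_0f=0$. Amalgam (quasi-)norm: $\|f\|_{L_{p,q}(\mathbb{R})}=\left(\sum_{j\in\mathbb{Z}}\left(\int_{A_j}|f|^p\,d\mathbb{P}\right)^{q/p}\right)^{1/q}$ for $0<p,q<\infty$, and $\|f\|_{L_{p,\infty}(\mathbb{R})}=\sup_{j\in\mathbb{Z}}\left(\int_{A_j}|f|^p\,d\mathbb{P}\right)^{1/p}$; $L_{p,q}(\mathbb{R})$ is the space of measurable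 functions for which it is finite. Operators: $f^*=\sup_n|f_n|$; $S_n(f)=\left(\sum_{i=0}^n|d_if|^2\right)^{1/2}$, $S(f)=\left(\sum_{i\ge0}|d_if|^2\right)^{1/2}$; $s(f)=\left(\sum_{i\ge0}\mathbb{E}_{i-1}|d_if|^2\right)^{1/2}$ (the $i=0$ term is $0$). Spaces: $H^S_{p,q}(\mathbb{R})$, $H^s_{p,q}(\mathbb{R})$, $H^*_{p,q}(\mathbb{R})$ are the spaces of $f\in\mathcal{M}$ for which $\|f\|_{H^S_{p,q}(\mathbb{R})}:=\|S(f)\|_{L_{p,q}(\mathbb{R})}$, $\|f\|_{H^s_{p,q}(\mathbb{R})}:=\|s(f)\|_{L_{p,q}(\mathbb{R})}$, $\|f\|_{H^*_{p,q}(\mathbb{R})}:=\|f^*\|_{L_{p,q}(\mathbb{R})}$, respectively, is finite. Let $\rho$ be the set of adapted, non-decreasing, non-negative sequences $\varrho=(\varrho_n)_{n\ge0}$ of functions, with $\varrho_\infty=\lim_n\varrho_n$. $\mathcal{Q}_{p,q}(\mathbb{R})$ (resp. $\mathcal{P}_{p,q}(\mathbb{R})$) is the space of $f\in\mathcal{M}$ for which there is $\varrho\in\rho$ with $S_n(f)\le\varrho_{n-1}$ (resp. $|f_n|\le\varrho_{n-1}$) for all $n\ge1$ and $\|\varrho_\infty\|_{L_{p,q}(\mathbb{R})}<\infty$; its (quasi-)norm is the infimum of $\|\varrho_\infty\|_{L_{p,q}(\mathbb{R})}$ over all such $\varrho$ (taken to be $+\infty$ if there is none). Regularity: $(\mathcal{F}_n)$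 is regular if there is $R>0$ such that $f_n\le Rf_{n-1}$ for all $n\ge1$ and all non-negative martingales $(f_n)_{n\ge0}$ with respect to $(\mathcal{F}_n)$ (here $f_0$ is not required to vanish). *)

(* Defs.v *)
From HB Require Import structures.
From mathcomp Require Import all_boot all_order all_algebra.
From mathcomp Require Import all_classical all_reals all_analysis.
From mathcomp Require Import measurable_realfun.

Set Implicit Arguments.
Unset Strict Implicit.
Unset Printing Implicit Defensive.

Import Order.TTheory GRing.Theory Num.Theory.
Import numFieldNormedType.Exports.

Local Open Scope classical_set_scope.
Local Open Scope ring_scope.

Definition dyadic_intervals (R : realType) (n : nat) : set (set R) :=
  range (fun k : int => `[k%:~R / 2 ^+ n, (k + 1)%:~R / 2 ^+ n[%classic).
Arguments dyadic_intervals : clear implicits.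

Definition dyadic_sigma (R : realType) (n : nat) : set (set R) :=
  <<s dyadic_intervals R n >>.
Arguments dyadic_sigma : clear implicits.

(* The real line equipped with F_n and with F, respectively.  Both types are
   convertible to R, so a function on R can be seen as a function on either. *)
Notation dyadic_level R n := (g_sigma_algebraType (dyadic_intervals R n)).
Notation dyadic_line R :=
  (g_sigma_algebraType (\bigcup_n dyadic_sigma R n)).

Section definitions.
Context {R : realType} (P : probability (dyadic_line R) R).

(* Relations between random variables hold P-almost everywhere: F_n may have
   P-null atoms, on which a version of a conditional expectation is
   arbitrary. *)

Definition adapted (f : nat -> R -> R) : Prop :=
  forall n, measurable_fun [set: dyadic_level R n]
    (f n : dyadic_level R n -> measurableTypeR R).

(* g is a version of E[h | F_n]; used for h integrable or h non-negative. *)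
Definition is_condexp (n : nat) (h g : R -> \bar R) : Prop :=
  measurable_fun [set: dyadic_level R n] (g : dyadic_level R n -> \bar R) /\
  forall A : set R, dyadic_sigma R n A ->
    (\int[P]_(x in A) g x = \int[P]_(x in A) h x)%E.

(* E_n h for a non-negative measurable h, with values in [0, +oo]: a version
   that is non-negative everywhere. Such versions exist and are unique up to
   P-null sets, hence the default value is irrelevant. *)
Definition condexp (n : nat) (h : R -> \bar R) : R -> \bar R :=
  xget (cst 0%E)
    [set g | (forall x, (0 <= g x)%E) /\ is_condexp n h g].

Definition is_martingale (f : nat -> R -> R) : Prop :=
  [/\ adapted f,
      forall n, P.-integrable [set: dyadic_line R] (EFin \o f n) &
      forall n, is_condexp n (EFin \o f n.+1) (EFin \o f n)].

Definition martingales0 : set (nat -> R -> R) :=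
  [set f | is_martingale f /\ {ae P, forall x, f 0%N x = 0}].

Definition regular_filtration : Prop :=
  exists K : R, 0 < K /\
    forall f, is_martingale f ->
      (forall n, {ae P, forall x, 0 <= f n x}) ->
      forall n, {ae P, forall x, f n.+1 x <= K * f n x}.

Definition unit_interval (j : int) : set R :=
  `[j%:~R, (j + 1)%:~R[%classic.

(* q ranges over ]0, +oo]; the value at -oo is never used. *)
Definition amalgam_norm (p : R) (q : \bar R) (f : R -> \bar R) : \bar R :=
  match q with
  | r%:E => ((\esum_(j in [set: int])
               (\int[P]_(x in unit_interval j) (`|f x| `^ p)) `^ (r / p))
             `^ r^-1)%E
  | +oo%E => ereal_sup (range (fun j : int =>
               (\int[P]_(x in unit_interval j) (`|f x| `^ p)) `^ p^-1)%E)
  | -oo%E => 0%E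
  end.

Definition mart_diff (f : nat -> R -> R) (n : nat) (x : R) : R :=
  if n is m.+1 then f n x - f m x else 0.

Definition maximal_fun (f : nat -> R -> R) (x : R) : \bar R :=
  ereal_sup (range (fun n => `|f n x|%:E)).

Definition square_fun_upto (f : nat -> R -> R) (n : nat) (x : R) : R :=
  Num.sqrt (\sum_(i < n.+1) `|mart_diff f i x| ^+ 2).

Definition square_fun (f : nat -> R -> R) (x : R) : \bar R :=
  sqrte (\sum_(0 <= i <oo) (`|mart_diff f i x| ^+ 2)%:E)%E.

Definition cond_square_fun (f : nat -> R -> R) (x : R) : \bar R :=
  sqrte (\sum_(0 <= i <oo)
    (if i is m.+1 then condexp m (fun y => (`|mart_diff f i y| ^+ 2)%:E) x
     else 0))%E.

(* Monotonicity and sign are required everywhere, so that the limit below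
   exists in [0, +oo] at every point. *)
Definition control_sequences : set (nat -> R -> R) :=
  [set rho | [/\ adapted rho,
                 forall n x, rho n x <= rho n.+1 x &
                 forall n x, 0 <= rho n x]].

Definition control_limit (rho : nat -> R -> R) (x : R) : \bar R :=
  limn (fun n => (rho n x)%:E).

Section spaces.
Variables (p : R) (q : \bar R).

Definition HS_norm (f : nat -> R -> R) : \bar R :=
  amalgam_norm p q (square_fun f).

Definition Hs_norm (f : nat -> R -> R) : \bar R :=
  amalgam_norm p q (cond_square_fun f).

Definition Hstar_norm (f : nat -> R -> R) : \bar R :=
  amalgam_norm p q (maximal_fun f).

Definition Q_controls (f : nat -> R -> R) : set (nat -> R -> R) :=
  [set rho | [/\ control_sequences rho,
    forall n, {ae P, forall x, square_fun_upto f n.+1 x <= rho n x} &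
    (amalgam_norm p q (control_limit rho) < +oo)%E]].

Definition P_controls (f : nat -> R -> R) : set (nat -> R -> R) :=
  [set rho | [/\ control_sequences rho,
    forall n, {ae P, forall x, `|f n.+1 x| <= rho n x} &
    (amalgam_norm p q (control_limit rho) < +oo)%E]].

Definition Q_norm (f : nat -> R -> R) : \bar R :=
  ereal_inf [set amalgam_norm p q (control_limit rho) | rho in Q_controls f].

Definition P_norm (f : nat -> R -> R) : \bar R :=
  ereal_inf [set amalgam_norm p q (control_limit rho) | rho in P_controls f].

Inductive hardy := HardyS | Hardys | HardyStar | HardyQ | HardyP.

Definition hardy_norm (X : hardy) : (nat -> R -> R) -> \bar R :=
  match X with
  | HardyS => HS_norm
  | Hardys => Hs_norm
  | HardyStar => Hstar_norm
  | HardyQ => Q_norm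
  | HardyP => P_norm
  end.

Definition hardy_space (X : hardy) : set (nat -> R -> R) :=
  match X with
  | HardyS => [set f | martingales0 f /\ (HS_norm f < +oo)%E]
  | Hardys => [set f | martingales0 f /\ (Hs_norm f < +oo)%E]
  | HardyStar => [set f | martingales0 f /\ (Hstar_norm f < +oo)%E]
  | HardyQ => [set f | martingales0 f /\ Q_controls f !=set0]
  | HardyP => [set f | martingales0 f /\ P_controls f !=set0]
  end.

End spaces.
End definitions.

(* Main.v *)
(* The unit intervals A_j belong to F_0, so every inequality reduces to one between
   integrals over A_j with a constant depending on p only. There the level-n functions
   take finitely many values, and points lying in a P-null dyadic interval can be
   discarded; on the remaining points almost everywhere relations hold everywhere and
   conditional expectations are averages. Put r = p / 2, and let F = (f^* )^2,
   SS = S(f)^2 and ss = s(f)^2, truncated at time N.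

   For r <= 1, let C be predictable, nondecreasing and V <= C, where V is one of f^2, SS,
   ss. Summation by parts gives sum C_k^(r-1) (V_k - V_(k-1)) <= C_N^r / r, and the left
   side has the same expectation as sum C_k^(r-1) (d_k f)^2. Hence the transform g of f
   by C^((r-1)/2) has E g_N^2 <= E C_N^r / r; undoing the transform, with Doob's L^2
   inequality for g and Young's inequality, bounds E F^r, E SS^r and E ss^r by E C_N^r.

   For r >= 1, Garsia's lemma (E_k[A_N - A_k] <= E_k[Z] for all k implies
   E A_N^r <= (2r)^r E Z^r) compares ss with SS, SS with 5 F, and F with
   eta F + (10 / eta) SS, where for small eta the term eta F is absorbed.

   If the filtration is regular, a nonnegative function of level n is at most K times its
   conditional expectation at level n-1. Thus K times the compensator of S_n(f)^p, or of the p-th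
   power of the running maximum, is a predictable majorant with comparable expectation;
   and S_n(f)^2 <= K s_n(f)^2. *)

Require Import Defs.
From mathcomp Require Import all_boot all_order all_algebra.
From mathcomp Require Import all_classical all_reals all_analysis.
From mathcomp Require Import measurable_realfun.
From mathcomp Require Import ring lra zify.

Set Implicit Arguments.
Unset Strict Implicit.
Unset Printing Implicit Defensive.

Import Order.TTheory GRing.Theory Num.Theory.
Import numFieldNormedType.Exports.

Local Open Scope classical_set_scope.
Local Open Scope ring_scope.

(** * Inequalities for real sequences *)

Section sequences.
Context {R : realType}.
Implicit Types (r t x y : R) (g e u V C : nat -> R).

(** The finite-horizon part contains no conditional expectations. A filtration there is a sequence
    of relations [eqv n], [E] is linear on level functions only, and E_n[d] = 0 is read as
    orthogonality to every level-[n] function. Over A_j such functions are bounded, so every moment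
    is a real number; this finiteness is what allows part of E A_N^r in Garsia's lemma, and the eta
    term in the bound for F, to be moved to the left side. The infinite horizon returns only through
    monotone convergence, so no constant may depend on N or j. For r <= 1 the obstacle is the
    negative power C^(r-1): C may vanish, so C + eps replaces it, and eps is removed after taking
    expectations, at the cost of 2^r. For p > 2 a control sequence is used only through the trivial
    bound: it dominates S(f), or the maximal function, pathwise, and the comparisons of Garsia type
    carry this bound to the other two operators. In the regular case four norms close the circle Q
    <= S <= P <= star <= Q up to constants, and s is compared with Q in both directions. *)

Lemma young_powR t (u v : R) : 0 <= t -> t <= 1 -> 0 <= u -> 0 <= v ->
  u `^ (1 - t) * v `^ t <= (1 - t) * u + t * v.
Proof.
move=> t0 t1 u0 v0.
have [->|tn0] := eqVneq t 0.
  by rewrite subr0 powRr1// powRr0 mulr1 mul1r mul0r addr0.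
have [->|tn1] := eqVneq t 1.
  by rewrite subrr powRr0 powRr1// !mul1r mul0r add0r.
have tp : 0 < t by rewrite lt_def tn0.
have tp1 : 0 < 1 - t by rewrite subr_gt0 lt_def eq_sym tn1.
have := @conjugate_powR _ (u `^ (1 - t)) (v `^ t) (1 - t)^-1 t^-1
  (powR_ge0 _ _) (powR_ge0 _ _).
rewrite !invr_gt0 !invrK => /(_ tp1 tp (subrK _ _)).
by rewrite -!powRrM !divff ?gt_eqF// !powRr1// (mulrC u) (mulrC v).
Qed.

(** From x + y <= 2 max(x, y). The constant is crude, but it serves both r <= 1 and r >= 1. *)
Lemma powR_add_le r x y : 0 <= r -> 0 <= x -> 0 <= y ->
  (x + y) `^ r <= 2 `^ r * (x `^ r + y `^ r).
Proof.
move=> r0 x0 y0; rewrite mulrDr -!powRM//.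
have [xy|/ltW yx] := leP x y.
  rewrite -[leLHS]add0r lerD ?powR_ge0//.
  by apply: ge0_ler_powR => //; rewrite ?nnegrE ?addr_ge0 ?mulr_ge0//; lra.
rewrite -[leLHS]addr0 lerD ?powR_ge0//.
by apply: ge0_ler_powR => //; rewrite ?nnegrE ?addr_ge0 ?mulr_ge0//; lra.
Qed.

Lemma ler0_powR r x y : r <= 0 -> 0 < x -> x <= y -> y `^ r <= x `^ r.
Proof.
move=> r0 x0 xy; have y0 := lt_le_trans x0 xy.
rewrite -(opprK r) !(powRN _ (- r)) lef_pV2 ?posrE ?powR_gt0//.
by apply: ge0_ler_powR; rewrite ?nnegrE ?oppr_ge0// ltW.
Qed.

(* The tangent inequality for the convex function [x `^ r]. *)
Lemma powR_sub_le r x y : 1 <= r -> 0 <= y -> y <= x ->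
  x `^ r - y `^ r <= r * ((x - y) * x `^ (r - 1)).
Proof.
move=> r1 y0 yx; have x0 := le_trans y0 yx; have rp := lt_le_trans ltr01 r1.
have /= := @young_powR r^-1 (x `^ r) (y `^ r) _ _ (powR_ge0 _ _) (powR_ge0 _ _).
rewrite invr_ge0 ltW// invf_le1// => /(_ isT r1).
rewrite -!powRrM mulfV ?gt_eqF// powRr1// mulrBr mulr1 mulfV ?gt_eqF//.
rewrite -(ler_pM2l rp) mulrDr !mulrA mulrBr mulr1 mulfV ?gt_eqF// mul1r.
have -> : x `^ r = x * x `^ (r - 1) by rewrite mulr_powRB1.
lra.
Qed.

Fixpoint runmax g (n : nat) : R :=
  if n is m.+1 then Num.max (runmax g m) `|g n| else `|g 0%N|.

Lemma runmax_ge0 g n : 0 <= runmax g n.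
Proof. by case: n => [|n] //=; rewrite le_max normr_ge0 orbT. Qed.

Lemma runmaxS g n : runmax g n <= runmax g n.+1.
Proof. by rewrite /= le_max lexx. Qed.

Lemma runmax_homo g m n : (m <= n)%N -> runmax g m <= runmax g n.
Proof. exact: (@homo_leq _ _ <=%O _ le_trans (runmaxS g)). Qed.

Lemma le_runmax g m n : (m <= n)%N -> `|g m| <= runmax g n.
Proof.
move=> mn; apply: le_trans (runmax_homo g mn).
by case: m {mn} => [|m] //=; rewrite le_max lexx orbT.
Qed.

Lemma runmax_le g n x : (forall m, (m <= n)%N -> `|g m| <= x) -> runmax g n <= x.
Proof.
elim: n => [|n IH] H /=; first exact: H.
by rewrite ge_max H// IH// => m mn; apply: H; exact: leqW.
Qed.

Lemma eq_runmax g e n : (forall m, (m <= n)%N -> g m = e m) ->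
  runmax g n = runmax e n.
Proof.
elim: n => [|n IH] H /=; first by rewrite H.
by rewrite H// IH// => m mn; apply: H; exact: leqW.
Qed.

Lemma runmax_attained g n : exists2 m, (m <= n)%N & runmax g n = `|g m|.
Proof.
elim: n => [|n [m mn IH]] /=; first by exists 0%N.
have [h|h] := leP (runmax g n) `|g n.+1|; first by exists n.+1.
by exists m => //; exact: leqW.
Qed.

(** A deterministic form of Doob's L^2 inequality: the sum is a discrete integral of the running
    maximum. Only steps where the maximum jumps from m to b lose something, namely (b - m)^2 / 2. *)
Lemma doob_pathwise g n :
  runmax g n ^+ 2 / 2 + \sum_(i < n) runmax g i * (`|g i.+1| - `|g i|)
  <= runmax g n * `|g n|.
Proof.
elim: n => [|n]; first by rewrite big_ord0/= addr0; have := normr_ge0 (g 0%N); nra.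
rewrite big_ord_recr /=.
set m := runmax g n; set b := `|g n.+1|; set a := `|g n|; set S := \sum_(_ < _) _.
move=> IH; have [bm|mb] := leP b m; first by nra.
suff : 0 <= (b - m) ^+ 2 by nra.
exact: sqr_ge0.
Qed.

Lemma weighted_sum_le r C V n : 0 < r -> r <= 1 ->
  (forall k, 0 < C k) -> (forall k, C k <= C k.+1) ->
  (forall k, 0 <= V k <= C k) ->
  \sum_(i < n) C i.+1 `^ (r - 1) * (V i.+1 - V i) <= r^-1 * C n `^ r.
Proof.
move=> r0 r1 C0 Cm V0.
have CE k : C k `^ r = C k * C k `^ (r - 1) by rewrite mulr_powRB1// ltW.
(* The boundary term of the summation by parts is kept so that the induction closes; it is
   nonnegative because V <= C. *)
suff H : \sum_(i < n) C i.+1 `^ (r - 1) * (V i.+1 - V i)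
    + (C n - V n) * C n `^ (r - 1) <= r^-1 * C n `^ r.
  apply: le_trans H; rewrite lerDl mulr_ge0 ?powR_ge0// subr_ge0.
  by case/andP: (V0 n).
elim: n => [|n IH].
  rewrite big_ord0 add0r CE; have /andP[v0 vC] := V0 0%N.
  have : 1 <= r^-1 by rewrite invf_ge1.
  have := powR_ge0 (C 0%N) (r - 1); have := C0 0%N.
  set w := _ `^ _; set s := r^-1 => c0 w0 s1.
  have : 0 <= w * C 0%N by rewrite mulr_ge0// ltW.
  nra.
rewrite big_ord_recr /=.
(* The tangent of the concave function t^r at C_(n+1), evaluated at C_n; it is an instance of
   Young's inequality. *)
have key : C n `^ r <= (1 - r) * C n.+1 `^ r + r * (C n * C n.+1 `^ (r - 1)).
  have := @young_powR r (C n.+1 `^ r) (C n * C n.+1 `^ (r - 1)) (ltW r0) r1.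
  have cn : 0 <= C n := ltW (C0 n).
  rewrite powR_ge0 mulr_ge0 ?powR_ge0// => /(_ isT isT); apply: le_trans.
  rewrite powRM ?powR_ge0// mulrCA -!powRrM -powRD; last first.
    by apply/implyP => _; rewrite gt_eqF.
  by rewrite (_ : _ + _ = 0) ?powRr0 ?mulr1//; ring.
have wle : C n.+1 `^ (r - 1) <= C n `^ (r - 1) by apply: ler0_powR; rewrite ?subr_le0.
have /andP[v0 vC] := V0 n; rewrite !CE in key IH *.
move: key IH wle; set w := C n `^ (r - 1); set w' := C n.+1 `^ (r - 1).
set S := \sum_(_ < _) _ => key IH wle.
have key2 : r^-1 * (C n * w) <= (r^-1 - 1) * (C n.+1 * w') + C n * w'.
  rewrite -(ler_pM2l r0) mulrA mulfV ?gt_eqF// mul1r mulrDr mulrA mulrBr mulr1.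
  by rewrite mulfV ?gt_eqF.
have : 0 <= (C n - V n) * (w - w') by rewrite mulr_ge0 ?subr_ge0.
nra.
Qed.

(* Summation by parts: [e i] equals [u i.+1] times the increment of the
   transformed sequence. *)
Lemma abel_transform_le u e n : (forall k, 0 < u k) -> (forall k, u k <= u k.+1) ->
  `|\sum_(i < n) e i| <=
  2 * (u n * runmax (fun k => \sum_(i < k) (u i.+1)^-1 * e i) n).
Proof.
move=> u0 um; set g := fun k => \sum_(i < k) _.
(* By parts the difference is minus the sum of (u_(i+1) - u_i) g_i, whose nonnegative weights add up
   to at most u_n. *)
have H : `|\sum_(i < n) e i - u n * g n| <= u n * runmax g n.
  elim: n => [|n IH].
    by rewrite /g !big_ord0 mulr0 subrr normr0 mulr_ge0// ?runmax_ge0 ?ltW.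
  have -> : \sum_(i < n.+1) e i - u n.+1 * g n.+1 =
     \sum_(i < n) e i - u n * g n - (u n.+1 - u n) * g n.
    rewrite /g !big_ord_recr/= mulrDr mulrA mulfV ?gt_eqF//; ring.
  apply: le_trans (ler_normB _ _) _.
  rewrite normrM (ger0_norm (_ : 0 <= u n.+1 - u n)) ?subr_ge0//.
  have h1 : (u n.+1 - u n) * `|g n| <= (u n.+1 - u n) * runmax g n.
    by rewrite ler_wpM2l ?subr_ge0// le_runmax.
  have h2 : u n.+1 * runmax g n <= u n.+1 * runmax g n.+1.
    by rewrite ler_wpM2l ?(ltW (u0 _))// runmaxS.
  lra.
have h3 : `|u n * g n| <= u n * runmax g n.
  by rewrite normrM gtr0_norm// ler_wpM2l ?(ltW (u0 _))// le_runmax.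
have := ler_normD (\sum_(i < n) e i - u n * g n) (u n * g n).
rewrite subrK; lra.
Qed.

End sequences.

(** * Martingale inequalities with finite horizon *)

Section finite_horizon.
Context {R : realType} {T : Type} (eqv : nat -> T -> T -> Prop)
  (E : (T -> R) -> R).

Definition level n (h : T -> R) := forall x y, eqv n x y -> h x = h y.

Context (eqvS : forall n x y, eqv n.+1 x y -> eqv n x y)
  (ED : forall n h g, level n h -> level n g ->
    E (fun x => h x + g x) = E h + E g)
  (EZ : forall n c h, level n h -> E (fun x => c * h x) = c * E h)
  (E_ge0 : forall h, (forall x, 0 <= h x) -> 0 <= E h).

Lemma level_le m n h : (m <= n)%N -> level m h -> level n h.
Proof.
move=> mn hm x y; suff : eqv n x y -> eqv m x y by move=> H /H /hm.
by rewrite -(subnK mn); elim: (n - m)%N => [//|k IH] /eqvS.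
Qed.

Lemma level_cst n c : level n (fun=> c). Proof. by []. Qed.

Lemma level1 (phi : R -> R) n h : level n h -> level n (fun x => phi (h x)).
Proof. by move=> H x y xy; rewrite (H x y xy). Qed.

Lemma level2 (phi : R -> R -> R) n h g : level n h -> level n g ->
  level n (fun x => phi (h x) (g x)).
Proof. by move=> H G x y xy; rewrite (H x y xy) (G x y xy). Qed.

Lemma level_sum n N (h : nat -> T -> R) : (forall i, (i < N)%N -> level n (h i)) ->
  level n (fun x => \sum_(i < N) h i x).
Proof. by move=> H x y xy; apply: eq_bigr => i _; exact: H. Qed.

Lemma level_runmax n N (g : T -> nat -> R) :
  (forall i, (i <= N)%N -> level n (g ^~ i)) -> level n (fun x => runmax (g x) N).
Proof. by move=> H x y xy; apply: eq_runmax => i iN; exact: (H i iN). Qed.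

Lemma eq_E h g : h =1 g -> E h = E g.
Proof. by move=> /funext ->. Qed.

Lemma EB n h g : level n h -> level n g -> E (fun x => h x - g x) = E h - E g.
Proof.
move=> H G; have := @ED n h (fun x => -1 * g x) H (@level1 (fun t => -1 * t) n g G).
by rewrite (@EZ n)// mulN1r => <-; apply: eq_E => x; rewrite mulN1r.
Qed.

Lemma E_le n h g : level n h -> level n g -> (forall x, h x <= g x) -> E h <= E g.
Proof.
by move=> H G hg; rewrite -subr_ge0 -(@EB n)//; apply: E_ge0 => x; rewrite subr_ge0.
Qed.

Lemma E0 : E (fun=> 0) = 0.
Proof.
rewrite -[RHS](mul0r (E (fun=> 0))) -(@EZ 0%N)//.
by apply: eq_E => x; rewrite mul0r.
Qed.

Lemma E_sum n N (h : nat -> T -> R) : (forall i, (i < N)%N -> level n (h i)) ->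
  E (fun x => \sum_(i < N) h i x) = \sum_(i < N) E (h i).
Proof.
elim: N => [|N IH] H.
  by rewrite big_ord0; apply: etrans E0; apply: eq_E => x; rewrite big_ord0.
rewrite big_ord_recr /= -IH => [|i iN]; last exact: H (leqW iN).
rewrite -(@ED n); [|by apply: level_sum => i iN; exact: H (leqW iN)|exact: H].
by apply: eq_E => x; rewrite big_ord_recr.
Qed.

(** [d n] is the increment from time [n] to [n.+1], hence of level [n.+1]; the second clause says
    that its conditional expectation at level [n] vanishes. *)
Definition mart_incr (d : nat -> T -> R) :=
  (forall n, level n.+1 (d n)) /\
  (forall n u, level n u -> E (fun x => u x * d n x) = 0).

Definition psum (d : nat -> T -> R) n x := \sum_(i < n) d i x.

Lemma psumS d n x : psum d n.+1 x = psum d n x + d n x.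
Proof. by rewrite /psum big_ord_recr. Qed.

Lemma psum0 d x : psum d 0 x = 0.
Proof. by rewrite /psum big_ord0. Qed.

Lemma level_psum d n : (forall i, (i < n)%N -> level n (d i)) -> level n (psum d n).
Proof. exact: level_sum. Qed.

Lemma level_mart d m n : mart_incr d -> (m <= n)%N -> level n (psum d m).
Proof.
move=> [dl _] mn; apply: (level_le mn); apply: level_psum => i im.
exact: (level_le im).
Qed.

(** The sum in [doob_pathwise] dominates the martingale transform by [u], because sg(a) b <= |a + b|
    - |a|, and the transform has mean zero. Then M |f| <= M^2 / 4 + f^2 leaves M^2 / 4 on the left,
    whence the 4. *)
Lemma doob d N : mart_incr d ->
  E (fun x => runmax (fun k => psum d k x) N ^+ 2) <= 4 * E (fun x => psum d N x ^+ 2).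
Proof.
move=> dm; have [dl d0] := dm.
pose m i x := runmax (fun k => psum d k x) i.
pose u i x := m i x * Num.sg (psum d i x).
have ml i n : (i <= n)%N -> level n (m i).
  move=> iN; apply: (@level_runmax _ _ (fun x k => psum d k x)) => j ji.
  by apply: (level_mart dm); exact: leq_trans iN.
have ul i : level i (u i).
  apply: (@level2 (fun a b => a * Num.sg b)); [exact: ml|exact: level_mart].
have sl i : (i < N)%N -> level N (fun x => u i x * d i x).
  move=> iN; apply: (@level2 (fun a b => a * b)).
    exact: (level_le (ltnW iN)).
  exact: (level_le iN).
have : E (fun x => 4^-1 * m N x ^+ 2 + \sum_(i < N) u i x * d i x) <=
       E (fun x => psum d N x ^+ 2).
  apply: (@E_le N).
  - apply: (@level2 (fun a b => a + b)); last exact: (level_sum sl).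
    by apply: (@level1 (fun t => 4^-1 * t ^+ 2)); exact: ml.
  - by apply: (@level1 (fun t => t ^+ 2)); exact: level_mart.
  - move=> x; have := doob_pathwise (fun k => psum d k x) N.
    rewrite -/(m N x).
    have : \sum_(i < N) u i x * d i x <=
        \sum_(i < N) m i x * (`|psum d i.+1 x| - `|psum d i x|).
      apply: ler_sum => i _; rewrite /u -mulrA ler_wpM2l ?runmax_ge0//.
      rewrite psumS; set a := psum d i x; set b := d i x.
      have := ler_norm (a + b); have := ler_norm (- (a + b)); rewrite normrN.
      by case: (sgrP a) => [->|ap|an]; rewrite ?normr0 ?add0r;
         set n := `|_|; lra.
    have : 0 <= (m N x / 2 - `|psum d N x|) ^+ 2 by exact: sqr_ge0.
    rewrite -[psum d N x ^+ 2]real_normK ?num_real//.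
    by set a := `|psum d N x|; set M := m N x; set S := \sum_(_ < _) _;
      set S' := \sum_(_ < _) _; nra.
rewrite (@ED N); last 2 first.
- by apply: (@level1 (fun t => 4^-1 * t ^+ 2)); exact: ml.
- exact: (level_sum sl).
rewrite (E_sum sl) big1 => [|i _]; last exact: d0.
rewrite (@EZ N); last by apply: (@level1 (fun t => t ^+ 2)); exact: ml.
by rewrite /m; set X := E _; set Y := E _; lra.
Qed.

(** The cross term 2 u f_n d_n has mean zero. *)
Lemma mart_sqr_incr d n u : mart_incr d -> level n u ->
  E (fun x => u x * (psum d n.+1 x ^+ 2 - psum d n x ^+ 2)) =
  E (fun x => u x * d n x ^+ 2).
Proof.
move=> dm ul; have dl : level n.+1 (d n) := dm.1 n.
have H : level n (fun x => 2 * (u x * psum d n x)).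
  by apply: (level2 (fun b c => 2 * (b * c))) => //; exact: level_mart.
rewrite -[RHS]addr0 -(dm.2 _ _ H) -(@ED n.+1).
- by apply: eq_E => x; rewrite psumS; ring.
- apply: (level2 (fun b c => b * c ^+ 2)) => //.
  exact: level_le ul.
- apply: (level2 (fun b c => b * c)) => //.
  exact: level_le H.
Qed.

Lemma E_mart_sqr d N : mart_incr d ->
  E (fun x => psum d N x ^+ 2) = E (fun x => \sum_(i < N) d i x ^+ 2).
Proof.
move=> dm; elim: N => [|N IH].
  by apply: eq_E => x; rewrite psum0 expr0n big_ord0.
have dl i : (i <= N)%N -> level N.+1 (fun x => d i x ^+ 2).
  move=> iN; apply: (level1 (fun t => t ^+ 2)).
  by apply: (level_le _ (dm.1 i)).
have pl i : (i <= N.+1)%N -> level N.+1 (fun x => psum d i x ^+ 2).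
  by move=> iN; apply: (level1 (fun t => t ^+ 2)); exact: level_mart.
have := mart_sqr_incr dm (@level_cst N 1).
rewrite (@eq_E _ (fun x => psum d N.+1 x ^+ 2 - psum d N x ^+ 2)); last first.
  by move=> x; rewrite mul1r.
rewrite (@EB N.+1); [|exact: pl|exact: pl].
move=> /eqP; rewrite subr_eq => /eqP ->.
rewrite addrC IH -(@ED N.+1); last 2 first.
- by apply: (@level_sum _ _ (fun i x => d i x ^+ 2)) => i iN; apply: dl; exact: ltnW.
- by apply: (level2 (fun b c => b * c)) => //; exact: dl.
by apply: eq_E => x; rewrite big_ord_recr/= mul1r.
Qed.

(** * Square functions and maximal function of one martingale *)

Section one_martingale.
Context (e a : nat -> T -> R) (em : mart_incr e)
  (al : forall n, level n (a n)) (a0 : forall n x, 0 <= a n x)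
  (ae2 : forall n u, level n u ->
    E (fun x => u x * a n x) = E (fun x => u x * e n x ^+ 2)).

(** [a n] stands for the conditional expectation of the square of [e n] at level [n], so [ss] is the
    compensator of [SS]. *)
Let f := psum e.
Let SS := psum (fun n x => e n x ^+ 2).
Let ss := psum a.
Let F n x := runmax (fun k => f k x) n ^+ 2.

Lemma level_f m n : (m <= n)%N -> level n (f m).
Proof. exact: level_mart. Qed.

Lemma level_e m n : (m < n)%N -> level n (e m).
Proof. by move=> mn; apply: (level_le mn); apply: em.1. Qed.

Lemma level_SS m n : (m <= n)%N -> level n (SS m).
Proof.
move=> mn; apply: level_sum => i im; apply: (level1 (fun t => t ^+ 2)).
by apply: level_e; exact: leq_trans mn.
Qed.

Lemma level_a m n : (m <= n)%N -> level n (a m).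
Proof. by move=> mn; apply: (level_le mn). Qed.

(** Predictability: [ss m] involves [a i] for i < m only, so level m - 1 already suffices. *)
Lemma level_ss m n : (m <= n.+1)%N -> level n (ss m).
Proof. by move=> mn; apply: level_sum => i im; apply: level_a; lia. Qed.

Lemma level_F m n : (m <= n)%N -> level n (F m).
Proof.
move=> mn; apply: (level1 (fun t => t ^+ 2)).
apply: (@level_runmax _ _ (fun x k => f k x)) => i im.
by apply: level_f; exact: leq_trans mn.
Qed.

Lemma SS_ge0 n x : 0 <= SS n x.
Proof. by apply: sumr_ge0 => i _; exact: sqr_ge0. Qed.

Lemma ss_ge0 n x : 0 <= ss n x.
Proof. by apply: sumr_ge0 => i _. Qed.

Lemma F_ge0 n x : 0 <= F n x.
Proof. exact: sqr_ge0. Qed.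

Lemma SS_homo x m n : (m <= n)%N -> SS m x <= SS n x.
Proof.
apply: (@homo_leq _ (SS ^~ x) <=%O (fun=> lexx _) le_trans) => i.
by rewrite /SS psumS lerDl sqr_ge0.
Qed.

Lemma ss_homo x m n : (m <= n)%N -> ss m x <= ss n x.
Proof.
apply: (@homo_leq _ (ss ^~ x) <=%O (fun=> lexx _) le_trans) => i.
by rewrite /ss psumS lerDl.
Qed.

Lemma F_homo x m n : (m <= n)%N -> F m x <= F n x.
Proof. by move=> mn; rewrite ler_pXn2r ?nnegrE ?runmax_ge0// runmax_homo. Qed.

Lemma sqr_f_le m n x : (m <= n)%N -> f m x ^+ 2 <= F n x.
Proof.
move=> mn; rewrite -real_normK ?num_real// ler_pXn2r ?nnegrE ?runmax_ge0//.
exact: (le_runmax (fun k => f k x)).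
Qed.

(* [V] has the same increments as [SS] up to martingale increments; this holds
   for [SS], for its compensator [ss] and for [f ^+ 2]. *)
Definition variation (V : nat -> T -> R) :=
  (forall n, level n (V n)) /\
  forall n u, level n u ->
    E (fun x => u x * (V n.+1 x - V n x)) = E (fun x => u x * e n x ^+ 2).

Lemma variation_SS : variation SS.
Proof.
split=> [n|n u ul]; first exact: level_SS.
by apply: eq_E => x; rewrite /SS psumS addrC addKr.
Qed.

Lemma variation_ss : variation ss.
Proof.
split=> [n|n u ul]; first exact: level_ss.
by rewrite -ae2//; apply: eq_E => x; rewrite /ss psumS addrC addKr.
Qed.

Lemma variation_f2 : variation (fun n x => f n x ^+ 2).
Proof.
split=> [n|n u ul]; first by apply: (level1 (fun t => t ^+ 2)); exact: level_f.
by rewrite mart_sqr_incr.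
Qed.

(** Telescoping: over a block from [k] to [N] any variation may be exchanged for [SS] under a test
    function of level [k]. This supplies the hypothesis of Garsia's lemma. *)
Lemma variation_sum V k N u : variation V -> (k <= N)%N -> level k u ->
  E (fun x => u x * (V N x - V k x)) = E (fun x => u x * (SS N x - SS k x)).
Proof.
move=> [Vl VE] kN ul; rewrite -(subnK kN); elim: (N - k)%N => [|i IH].
  by apply: eq_E => x; rewrite !subrr.
have ul' : level (i + k) u by apply: (level_le _ ul); lia.
have mul b c n : level n b -> level n c -> level n (fun x => b x * c x).
  exact: (level2 (fun b c => b * c)).
have sub b c n : level n b -> level n c -> level n (fun x => b x - c x).
  exact: (level2 (fun b c => b - c)).
have step W : variation W -> E (fun x => u x * (W (i + k).+1 x - W k x)) =
    E (fun x => u x * (W (i + k)%N x - W k x)) + E (fun x => u x * e (i + k)%N x ^+ 2).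
  move=> [Wl WE]; rewrite -WE// -(@ED (i + k).+1).
  - by apply: eq_E => x; ring.
  - by apply: mul; [apply: level_le ul|apply: sub; apply: level_le (Wl _)]; lia.
  - by apply: mul; [apply: level_le ul|apply: sub; apply: level_le (Wl _)]; lia.
by rewrite addSn (step V)// IH (step SS)//; exact: variation_SS.
Qed.

(** * Exponents r <= 1: domination by a predictable process *)

Section small_exponent.
Context (r : R) (r0 : 0 < r) (r1 : r <= 1).

Section positive_control.
Context (C V : nat -> T -> R) (Vv : variation V) (C0 : forall k x, 0 < C k x)
  (Cm : forall k x, C k x <= C k.+1 x) (Cl : forall k, level k (C k.+1))
  (Cl0 : level 0 (C 0%N)) (V0 : forall k x, 0 <= V k x <= C k x).

(** The weight of index [i.+1] is still of level [i], since [C] is predictable; so it may multiply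
    the increment [d i] under [E]. *)
Let W (d : nat -> T -> R) N x := \sum_(i < N) C i.+1 x `^ (r - 1) * d i x.

Lemma level_C m n : (m <= n.+1)%N -> level n (C m).
Proof.
case: m => [|m] mn; first exact: level_le Cl0.
by apply: (level_le _ (@Cl m)); lia.
Qed.

Lemma level_w i : level i (fun x => C i.+1 x `^ (r - 1)).
Proof. by apply: (level1 (fun t => t `^ (r - 1))). Qed.

Lemma level_W d N : (forall i, (i < N)%N -> level N (d i)) -> level N (W d N).
Proof.
move=> dl; apply: (@level_sum _ _ (fun i x => C i.+1 x `^ (r - 1) * d i x)) => i iN.
apply: (level2 (fun b c => b `^ (r - 1) * c)); last exact: dl.
by apply: level_C; exact: leqW.
Qed.

Lemma level_Wd d N i : (i < N)%N -> level N (d i) ->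
  level N (fun x => C i.+1 x `^ (r - 1) * d i x).
Proof.
move=> iN dl; apply: (level2 (fun b c => b `^ (r - 1) * c)) => //.
by apply: level_C; lia.
Qed.

Lemma level_Cr N : level N (fun x => C N x `^ r).
Proof. by apply: (level1 (fun t => t `^ r)); apply: level_C. Qed.

Let e2 i x := e i x ^+ 2.

Lemma level_e2 i N : (i < N)%N -> level N (e2 i).
Proof. by move=> iN; apply: (level1 (fun t => t ^+ 2)); exact: level_e. Qed.

Lemma weighted_SS N : E (W e2 N) <= r^-1 * E (fun x => C N x `^ r).
Proof.
have Vl i N' : (i <= N')%N -> level N' (V i) by move=> iN; apply: level_le (Vv.1 i).
pose dV i x := V i.+1 x - V i x.
have dVl i : (i < N)%N -> level N (dV i).
  by move=> iN; apply: (level2 (fun b c => b - c)); apply: Vl => //; lia.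
have -> : E (W e2 N) = E (W dV N).
  rewrite !(@E_sum N _ (fun i x => C i.+1 x `^ (r - 1) * _ i x)).
  - by apply: eq_bigr => i _; rewrite (Vv.2 _ _ (@level_w i)).
  - by move=> i iN; apply: level_Wd => //; exact: dVl.
  - by move=> i iN; apply: level_Wd => //; exact: level_e2.
rewrite -(@EZ N); last exact: level_Cr.
apply: (@E_le N).
- exact: level_W.
- by apply: (level1 (fun t => r^-1 * t)); exact: level_Cr.
- by move=> x; apply: (@weighted_sum_le _ r (C ^~ x) (V ^~ x)).
Qed.

Lemma weighted_ss N : E (W a N) = E (W e2 N).
Proof.
rewrite !(@E_sum N _ (fun i x => C i.+1 x `^ (r - 1) * _ i x)).
- by apply: eq_bigr => i _; rewrite ae2//; exact: (@level_w i).
- by move=> i iN; apply: level_Wd => //; exact: level_e2.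
- by move=> i iN; apply: level_Wd => //; apply: level_a; exact: ltnW.
Qed.

(** Removes the weight: the r-th power of C^(1-r) Y is (C^r)^(1-r) Y^r, which Young's inequality
    bounds by C^r + Y. *)
Lemma E_powR_le N k (X Y : T -> R) : 0 <= k -> level N X -> level N Y ->
  (forall x, 0 <= X x) -> (forall x, 0 <= Y x) ->
  (forall x, X x <= k * (C N x `^ (1 - r) * Y x)) ->
  E Y <= 4 * r^-1 * E (fun x => C N x `^ r) ->
  E (fun x => X x `^ r) <= k `^ r * (1 + 4 * r^-1) * E (fun x => C N x `^ r).
Proof.
move=> k0 Xl Yl X0 Y0 XY EY.
have Crl := @level_Cr N.
have : E (fun x => X x `^ r) <= E (fun x => k `^ r * (C N x `^ r + Y x)).
  apply: (@E_le N).
  - exact: (level1 (fun t => t `^ r)).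
  - exact: (level2 (fun b c => k `^ r * (b + c))).
  move=> x; have cx0 := C0 N x.
  apply: (@le_trans _ _ ((k * (C N x `^ (1 - r) * Y x)) `^ r)).
    apply: ge0_ler_powR; rewrite ?nnegrE ?(ltW r0)//.
    by rewrite !mulr_ge0 ?powR_ge0.
  rewrite powRM ?mulr_ge0 ?powR_ge0// ler_wpM2l ?powR_ge0//.
  rewrite powRM ?powR_ge0// -powRrM mulrC [X in C N x `^ X]mulrC powRrM mulrC.
  have := @young_powR _ r (C N x `^ r) (Y x) (ltW r0) r1 (powR_ge0 _ _) (Y0 x).
  move/le_trans; apply; have := Y0 x; have := powR_ge0 (C N x) r.
  set c := _ `^ _ => c0 y0; rewrite mulrBl mul1r; have := r1; have := r0; nra.
move/le_trans; apply; rewrite (@EZ N); last exact: (level2 (fun b c => b + c)).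
by rewrite (@ED N)// -mulrA ler_wpM2l ?powR_ge0// mulrDl mul1r lerD2l.
Qed.

Let powRB1_1 x i : C i x `^ (1 - r) * C i x `^ (r - 1) = 1.
Proof.
rewrite -powRD; last by apply/implyP => _; rewrite gt_eqF.
by rewrite (_ : _ + _ = 0) ?powRr0//; ring.
Qed.

Lemma C_homo x m n : (m <= n)%N -> C m x <= C n x.
Proof. exact: (@homo_leq _ (C ^~ x) <=%O (fun=> lexx _) le_trans). Qed.

Lemma psum_le_W d N x : (forall i, 0 <= d i x) ->
  psum d N x <= C N x `^ (1 - r) * W d N x.
Proof.
move=> d0; rewrite mulr_sumr; apply: ler_sum => i _.
rewrite mulrA ler_peMl//; rewrite -[leLHS](powRB1_1 x i.+1).
rewrite ler_wpM2r ?powR_ge0//.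
by apply: ge0_ler_powR; rewrite ?subr_ge0 ?nnegrE ?(ltW (C0 _ _))// C_homo.
Qed.

Lemma EC_ge0 N : 0 <= E (fun x => C N x `^ r).
Proof. by apply: E_ge0 => x; exact: powR_ge0. Qed.

(** [E_powR_le] carries the factor 4 that Doob's inequality costs for [F]; the bounds for [SS] and
    [ss] are weakened to the same form. *)
Let leK N (A : R) : A <= r^-1 * E (fun x => C N x `^ r) ->
  A <= 4 * r^-1 * E (fun x => C N x `^ r).
Proof.
move=> h; apply: (le_trans h); rewrite -mulrA.
have : 0 <= r^-1 * E (fun x => C N x `^ r) by rewrite mulr_ge0 ?EC_ge0// invr_ge0 ltW.
set A' := _ * _; lra.
Qed.

(** The increments are divided by u = C^((1-r)/2), so that the square function of the transform has
    the weight C^(r-1) of [weighted_SS]. Undoing this with [abel_transform_le] costs 2, whose square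
    is the [k = 4] passed to [E_powR_le]. *)
Lemma E_F_le_pos N : E (fun x => F N x `^ r) <=
  4 `^ r * (1 + 4 * r^-1) * E (fun x => C N x `^ r).
Proof.
pose u k x := C k x `^ ((1 - r) / 2).
have u0 k x : 0 < u k x by rewrite powR_gt0.
have um k x : u k x <= u k.+1 x.
  by apply: ge0_ler_powR; rewrite ?nnegrE ?(ltW (C0 _ _))// divr_ge0 ?subr_ge0.
have u2 k x : u k x ^+ 2 = C k x `^ (1 - r).
  by rewrite /u -powR_mulrn ?powR_ge0// -powRrM divfK// pnatr_eq0.
have ui2 k x : (u k x)^-1 ^+ 2 = C k x `^ (r - 1).
  by rewrite exprVn u2 -powRN opprB.
pose d i x := (u i.+1 x)^-1 * e i x.
have dm : mart_incr d.
  split=> [n|n w wl].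
    apply: (@level2 (fun b c => (b `^ ((1 - r) / 2))^-1 * c) _ (C n.+1) (e n)).
      exact: level_C.
    exact: level_e.
  rewrite -(em.2 n (fun x => w x * (u n.+1 x)^-1)).
    by apply: eq_E => x; rewrite /d mulrA.
  apply: (@level2 (fun b c => b * (c `^ ((1 - r) / 2))^-1) _ w (C n.+1)) => //.
have gl : level N (fun x => runmax (fun k => psum d k x) N).
  by apply: (@level_runmax _ _ (fun x k => psum d k x)) => i iN; exact: level_mart.
have gl2 := level1 (fun t => t ^+ 2) gl.
apply: (@E_powR_le N 4 _ (fun x => runmax (fun k => psum d k x) N ^+ 2)) => //.
- exact: level_F.
- by move=> x; exact: F_ge0.
- by move=> x; exact: sqr_ge0.
- move=> x; rewrite -u2 -exprMn.
  rewrite (_ : 4 * _ = (2 * (u N x * runmax (fun k => psum d k x) N)) ^+ 2); last by ring.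
  rewrite ler_pXn2r ?nnegrE ?runmax_ge0//; last first.
    by rewrite !mulr_ge0 ?runmax_ge0// ltW.
  apply: runmax_le => m mN.
  have := @abel_transform_le _ (u ^~ x) (e ^~ x) m (u0 ^~ x) (um ^~ x).
  move/le_trans; apply; rewrite ler_pM2l//.
  apply: ler_pM; rewrite ?runmax_ge0 ?(ltW (u0 _ _))//; last exact: runmax_homo.
  exact: (@homo_leq _ (u ^~ x) <=%O (fun=> lexx _) le_trans).
- apply: (le_trans (doob _ dm)); rewrite -mulrA ler_pM2l//.
  apply: le_trans (weighted_SS N); rewrite E_mart_sqr//; 
  rewrite [leLHS](_ : _ = E (W e2 N))//.
  by apply: eq_E => x; apply: eq_bigr => i _; rewrite exprMn ui2.
Qed.

Lemma E_SS_le_pos N : E (fun x => SS N x `^ r) <=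
  1 `^ r * (1 + 4 * r^-1) * E (fun x => C N x `^ r).
Proof.
apply: (@E_powR_le N 1 _ (W e2 N)) => //.
- exact: level_SS.
- by apply: level_W => i iN; exact: level_e2.
- exact: SS_ge0.
- by move=> x; apply: sumr_ge0 => i _; rewrite mulr_ge0 ?powR_ge0 ?sqr_ge0.
- by move=> x; rewrite mul1r; apply: psum_le_W => i; exact: sqr_ge0.
- by apply: leK; exact: weighted_SS.
Qed.

Lemma E_ss_le_pos N : E (fun x => ss N x `^ r) <=
  1 `^ r * (1 + 4 * r^-1) * E (fun x => C N x `^ r).
Proof.
apply: (@E_powR_le N 1 _ (W a N)) => //.
- exact: level_ss.
- by apply: level_W => i iN; apply: level_a; exact: ltnW.
- exact: ss_ge0.
- by move=> x; apply: sumr_ge0 => i _; rewrite mulr_ge0 ?powR_ge0.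
- by move=> x; rewrite mul1r; apply: psum_le_W.
- by apply: leK; rewrite weighted_ss; exact: weighted_SS.
Qed.

End positive_control.
(** [C] bounds [V] at the same index but is known one step earlier. Both a shifted control sequence
    and [ss], which dominates itself, have this form. *)
Definition dominated (V C : nat -> T -> R) :=
  [/\ forall k, level k (C k.+1), level 0 (C 0%N),
      forall k x, C k x <= C k.+1 x & forall k x, 0 <= V k x <= C k x].

(** The second factor is the constant for a positive control; the first is the price of replacing C
    by C + eps. *)
Definition small_cst := 2 `^ r * (4 `^ r * (1 + 4 * r^-1)).

Lemma small_cst_gt0 : 0 < small_cst.
Proof. by rewrite !mulr_gt0 ?powR_gt0// addr_gt0// mulr_gt0// invr_gt0. Qed.

(* Adding [eps] to the control makes its negative powers harmless. *)
Lemma dominated_pos V C N A : dominated V C ->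
  (forall C', (forall k x, 0 < C' k x) -> dominated V C' ->
     A <= 4 `^ r * (1 + 4 * r^-1) * E (fun x => C' N x `^ r)) ->
  A <= small_cst * E (fun x => C N x `^ r).
Proof.
move=> [Cl Cl0 Cm V0] H; set K := _ * _ in H; rewrite /small_cst -/K.
have CN : level N (C N) by case: (N) => // n; exact: level_le (@Cl n).
have c0 k x : 0 <= C k x by have /andP[/le_trans v /v] := V0 k x.
have K0 : 0 < K by rewrite !mulr_gt0 ?powR_gt0// addr_gt0// mulr_gt0// invr_gt0.
set M := 2 `^ r * K * E (fun=> 1).
have M0 : 0 <= M.
  by rewrite mulr_ge0// ?E_ge0// mulr_ge0 ?powR_ge0// ltW.
apply/ler_addgt0Pr => del del0.
(* Chosen so that eps^r M <= del; the + 1 covers M = 0, which can occur because [E] is not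
   normalised. *)
pose eps := (del / (M + 1)) `^ r^-1.
have M1 : 0 < M + 1 by rewrite ltr_wpDl.
have eps0 : 0 < eps by rewrite powR_gt0// divr_gt0.
have epsr : eps `^ r = del / (M + 1).
  by rewrite -powRrM mulVf ?gt_eqF// powRr1// divr_ge0// ltW.
apply: le_trans (H (fun k x => C k x + eps) _ _) _.
- by move=> k x; rewrite ltr_wpDl.
- split=> [k||k x|k x].
  + by apply: (@level1 (fun t => t + eps) _ (C k.+1)).
  + by apply: (@level1 (fun t => t + eps) _ (C 0%N)).
  + by rewrite lerD2r.
  + by have /andP[-> /= v] := V0 k x; rewrite ler_wpDr// ltW.
have : E (fun x => (C N x + eps) `^ r) <= E (fun x => 2 `^ r * (C N x `^ r + eps `^ r * 1)).
  apply: (@E_le N).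
  - exact: (@level1 (fun t => (t + eps) `^ r)).
  - exact: (@level1 (fun t => 2 `^ r * (t `^ r + eps `^ r * 1))).
  - by move=> x; rewrite mulr1 powR_add_le// ltW.
move/(ler_wpM2l (ltW K0))/le_trans; apply.
rewrite (@EZ N); last exact: (@level1 (fun t => t `^ r + eps `^ r * 1)).
rewrite (@ED N)//; last exact: (@level1 (fun t => t `^ r)).
rewrite (@EZ N)// mulrCA mulrA mulrDr lerD2l mulrCA -/M epsr.
by rewrite mulrAC ler_pdivrMr// ler_wpM2l ?(ltW del0)// lerDl.
Qed.

Lemma E_F_small V C N : variation V -> dominated V C ->
  E (fun x => F N x `^ r) <= small_cst * E (fun x => C N x `^ r).
Proof.
move=> Vv /dominated_pos; apply=> C' C'0 [Cl Cl0 Cm V0].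
exact: (@E_F_le_pos C' V).
Qed.

Lemma small_cst_weaken (A : R) : 0 <= A ->
  1 `^ r * (1 + 4 * r^-1) * A <= 4 `^ r * (1 + 4 * r^-1) * A.
Proof.
move=> A0; rewrite -!mulrA ler_wpM2r//; last first.
  by apply: ge0_ler_powR; rewrite ?nnegrE ?(ltW r0)//; lra.
by rewrite mulr_ge0// addr_ge0// mulr_ge0// invr_ge0 ltW.
Qed.

Lemma E_SS_small V C N : variation V -> dominated V C ->
  E (fun x => SS N x `^ r) <= small_cst * E (fun x => C N x `^ r).
Proof.
move=> Vv /dominated_pos; apply=> C' C'0 [Cl Cl0 Cm V0].
apply: le_trans (@small_cst_weaken _ _); first exact: (@E_SS_le_pos C' V).
exact: EC_ge0.
Qed.

Lemma E_ss_small V C N : variation V -> dominated V C ->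
  E (fun x => ss N x `^ r) <= small_cst * E (fun x => C N x `^ r).
Proof.
move=> Vv /dominated_pos; apply=> C' C'0 [Cl Cl0 Cm V0].
apply: le_trans (@small_cst_weaken _ _); first exact: (@E_ss_le_pos C' V).
exact: EC_ge0.
Qed.

End small_exponent.

(** * Exponents r >= 1: Garsia's lemma *)

Section large_exponent.
Context (r : R) (r1 : 1 <= r).

Let r0 : 0 < r. Proof. exact: lt_le_trans r1. Qed.

(* The case [k = 0] matters for [r = 1], where [0 `^ (r - 1) = 1]. *)
Definition powR1_from0 (A : nat -> R) k := if k is _.+1 then A k `^ (r - 1) else 0.

(** The tangent inequality followed by summation by parts. It brings out the tails A_N - A_i, which
    are what the hypothesis of Garsia's lemma controls. *)
Lemma powR_abel_le (A : nat -> R) N : A 0%N = 0 -> (forall k, A k <= A k.+1) ->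
  A N `^ r <= r * \sum_(i < N) (powR1_from0 A i.+1 - powR1_from0 A i) * (A N - A i).
Proof.
move=> A0 Am; pose b := powR1_from0 A; rewrite -/b.
have Age k : 0 <= A k by elim: k => [|k IH]; [rewrite A0|exact: le_trans (Am k)].
suff [H1 H2] : A N `^ r <= r * \sum_(i < N) (A i.+1 - A i) * b i.+1 /\
  \sum_(i < N) (A i.+1 - A i) * b i.+1 = \sum_(i < N) (b i.+1 - b i) * (A N - A i).
  by rewrite -H2.
split.
  elim: N => [|n IH]; first by rewrite big_ord0 mulr0 A0 powR0// gt_eqF.
  rewrite big_ord_recr /= mulrDr.
  have := powR_sub_le r1 (Age n) (Am n); lra.
elim: N => [|n IH]; first by rewrite !big_ord0.
rewrite !big_ord_recr/= IH.
have -> : \sum_(i < n) (b i.+1 - b i) * (A n.+1 - A i) =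
   \sum_(i < n) (b i.+1 - b i) * (A n - A i) + b n * (A n.+1 - A n).
  have -> : b n = \sum_(i < n) (b i.+1 - b i).
    elim: (n) => [|m IHm]; first by rewrite big_ord0.
    by rewrite big_ord_recr -IHm /= addrC subrK.
  by rewrite mulr_suml -big_split; apply: eq_bigr => i _ /=; ring.
set B := A n.+1 `^ _; ring.
Qed.

(* Garsia's lemma; [mu k = k] for predictable [A], [mu k = k.+1] for adapted [A]. *)
Lemma garsia (mu : nat -> nat) (A : nat -> T -> R) (Z : T -> R) N :
  (forall k, k <= mu k)%N -> (forall k, k < N -> mu k <= N)%N ->
  (forall k, level (mu k) (A k)) -> (forall k, level (mu k) (A k.+1)) ->
  level N (A N) -> level N Z -> (forall x, 0 <= Z x) ->
  (forall x, A 0%N x = 0) -> (forall k x, A k x <= A k.+1 x) ->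
  (forall k h, (k < N)%N -> level (mu k) h -> (forall x, 0 <= h x) ->
     E (fun x => h x * (A N x - A k x)) <= E (fun x => h x * Z x)) ->
  E (fun x => A N x `^ r) <= (2 * r) `^ r * E (fun x => Z x `^ r).
Proof.
move=> muk muN Al Al1 AN Zl Z0 A0 Am H.
have Age k x : 0 <= A k x.
  by elim: k => [|k IH]; [rewrite A0|exact: le_trans (Am k x)].
pose b k x := powR1_from0 (A ^~ x) k.
(* These are the test functions for the hypothesis: nonnegative since r >= 1, of level [mu k], and
   with sum [b N] because [b 0] vanishes. *)
pose h k x := b k.+1 x - b k x.
have h0 k x : 0 <= h k x.
  rewrite subr_ge0; case: k => [|k] /=; first exact: powR_ge0.
  by apply: ge0_ler_powR; rewrite ?subr_ge0 ?nnegrE.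
have hl k : level (mu k) (h k).
  apply: (level2 (fun b c => b - c)).
    by apply: (@level1 (fun t => t `^ (r - 1)) _ (A k.+1)); exact: Al1.
  case: k => [|k] //; apply: (@level1 (fun t => t `^ (r - 1)) _ (A k.+1)).
  exact: Al.
have hN k : (k < N)%N -> level N (h k).
  by move=> kN; apply: level_le (@hl k); exact: muN.
have AlN k : (k < N)%N -> level N (A k).
  by move=> kN; apply: level_le (@Al k); exact: muN.
have mul u v : level N u -> level N v -> level N (fun x => u x * v x).
  exact: (level2 (fun b c => b * c)).
have sub u v : level N u -> level N v -> level N (fun x => u x - v x).
  exact: (level2 (fun b c => b - c)).
have powl u : level N u -> level N (fun x => u x `^ r).
  exact: (level1 (fun t => t `^ r)).
have s1 : E (fun x => A N x `^ r) <=
    r * E (fun x => \sum_(i < N) h i x * (A N x - A i x)).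
  rewrite -(@EZ N); last first.
    apply: (@level_sum _ _ (fun i x => h i x * (A N x - A i x))) => i iN.
    by apply: mul; [exact: hN|apply: sub => //; exact: AlN].
  apply: (@E_le N); [exact: powl| |].
    apply: (@level1 (fun t => r * t)).
    apply: (@level_sum _ _ (fun i x => h i x * (A N x - A i x))) => i iN.
    by apply: mul; [exact: hN|apply: sub => //; exact: AlN].
  move=> x; apply: (@powR_abel_le (A ^~ x)) => //.
have s2 : E (fun x => \sum_(i < N) h i x * (A N x - A i x)) <=
    E (fun x => b N x * Z x).
  rewrite (@E_sum N _ (fun i x => h i x * (A N x - A i x))); last first.
    by move=> i iN; apply: mul; [exact: hN|apply: sub => //; exact: AlN].
  have -> : E (fun x => b N x * Z x) = E (fun x => \sum_(i < N) h i x * Z x).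
    apply: eq_E => x; rewrite -mulr_suml; congr (_ * _).
    elim: (N) => [|m IHm]; first by rewrite big_ord0.
    by rewrite big_ord_recr -IHm /= addrC subrK.
  rewrite (@E_sum N _ (fun i x => h i x * Z x)); last first.
    by move=> i iN; apply: mul => //; exact: hN.
  by apply: ler_sum => i _; apply: H.
(* Young's inequality for r A^(r-1) Z = A^(r-1) (2 r Z) / 2. The factor 2 r is placed on Z so that
   at most half of A^r remains, to be absorbed on the left. *)
have s3 : r * E (fun x => b N x * Z x) <=
    E (fun x => 2^-1 * (A N x `^ r + (2 * r) `^ r * Z x `^ r)).
  have bN : level N (b N).
    by case: (N) AN => // n ?; apply: (level1 (fun t => t `^ (r - 1))).
  rewrite -(@EZ N); last exact: mul.
  apply: (@E_le N).
  - exact: (level2 (fun b c => r * (b * c))).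
  - exact: (level2 (fun b c => 2^-1 * (b `^ r + (2 * r) `^ r * c `^ r))).
  move=> x.
  have bA : b N x <= A N x `^ (r - 1) by case: (N) => [|n] //=; rewrite powR_ge0.
  have := @young_powR _ r^-1 (A N x `^ r) ((2 * r * Z x) `^ r).
  rewrite !powR_ge0 invr_ge0 (ltW r0) invf_le1// r1 => /(_ isT isT isT isT).
  have rz0 : 0 <= 2 * r * Z x by rewrite !mulr_ge0// ltW.
  rewrite -!powRrM mulfV ?gt_eqF// powRr1//.
  rewrite mulrBr mulr1 mulfV ?gt_eqF// [X in _ + r^-1 * X]powRM ?mulr_ge0 ?(ltW r0)//.
  have : r^-1 <= 1 by rewrite invf_le1.
  have : 0 <= r^-1 by rewrite invr_ge0 ltW.
  have := powR_ge0 (A N x) r; have := powR_ge0 (2 * r) r; have := powR_ge0 (Z x) r.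
  set P := Z x `^ r; set Q := (2 * r) `^ r; set S := A N x `^ r; set q := r^-1.
  move=> P0 Q0 S0 q0 q1 Y.
  have : r * (b N x * Z x) <= r * (A N x `^ (r - 1) * Z x).
    by rewrite ler_pM2l// ler_wpM2r.
  have : 0 <= Q * P by exact: mulr_ge0.
  move: Y; set B := A N x `^ (r - 1); set V := Q * P; nra.
have s4 : E (fun x => 2^-1 * (A N x `^ r + (2 * r) `^ r * Z x `^ r)) =
  2^-1 * (E (fun x => A N x `^ r) + (2 * r) `^ r * E (fun x => Z x `^ r)).
  rewrite (@EZ N); last exact: (level2 (fun b c => b `^ r + (2 * r) `^ r * c `^ r)).
  rewrite (@ED N); [|exact: powl|exact: (level1 (fun t => (2 * r) `^ r * t `^ r))].
  by rewrite (@EZ N)//; exact: powl.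
have := ler_wpM2l (ltW r0) s2; move: s1 s3; rewrite s4.
set X := E _; set Y := E _; set Y' := E _; set Y'' := E _; lra.
Qed.

(** [ss] is predictable, so level-[k] test functions suffice, and against these the tail of [ss]
    equals the tail of [SS], which is at most SS_N. *)
Lemma E_ss_large N :
  E (fun x => ss N x `^ r) <= (2 * r) `^ r * E (fun x => SS N x `^ r).
Proof.
apply: (garsia (mu := id)) => //.
- by move=> k kN; exact: ltnW.
- by move=> k; exact: level_ss.
- by move=> k; exact: level_ss.
- exact: level_ss.
- exact: level_SS.
- by move=> x; exact: SS_ge0.
- by move=> x; exact: psum0.
- by move=> k x; exact: ss_homo.
move=> k h kN hl h0; rewrite (variation_sum variation_ss) ?(ltnW kN)//.
apply: (@E_le N).
- apply: (level2 (fun b c => b * c)); first exact: level_le (ltnW kN) hl.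
  by apply: (level2 (fun b c => b - c)); apply: level_SS => //; exact: ltnW.
- apply: (level2 (fun b c => b * c)); first exact: level_le (ltnW kN) hl.
  exact: level_SS.
- by move=> x; rewrite ler_wpM2l// gerBl SS_ge0.
Qed.

(** [SS] is merely adapted, so test functions have level [k.+1]: the term e_k^2 is split off and
    only the tail after [k.+1] is exchanged for f_N^2 - f_(k+1)^2. With e_k^2 <= 2 f_k^2 + 2
    f_(k+1)^2 the total stays below 5 F_N. *)
Lemma E_SS_large N :
  E (fun x => SS N x `^ r) <= (2 * r) `^ r * 5 `^ r * E (fun x => F N x `^ r).
Proof.
have FN := @level_F _ _ (leqnn N).
rewrite -mulrA -(@EZ N); last exact: (level1 (fun t => t `^ r)).
rewrite [X in _ * X](_ : _ = E (fun x => (5 * F N x) `^ r)); last first.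
  by apply: eq_E => x; rewrite powRM// F_ge0.
apply: (garsia (mu := succn)) => //.
- by move=> k; exact: level_SS.
- by move=> k; exact: level_SS.
- exact: level_SS.
- exact: (level1 (fun t => 5 * t)).
- by move=> x; rewrite mulr_ge0// F_ge0.
- by move=> x; exact: psum0.
- by move=> k x; exact: SS_homo.
move=> k h kN hl h0.
have hN : level N h by exact: level_le kN hl.
have mul u v : level N u -> level N v -> level N (fun x => u x * v x).
  exact: (level2 (fun b c => b * c)).
have SSN m : (m <= N)%N -> level N (SS m) by move=> mN; exact: level_SS.
have fN m : (m <= N)%N -> level N (f m) by move=> mN; exact: level_f.
have eN : level N (fun x => h x * e k x ^+ 2).
  by apply: mul => //; apply: (level1 (fun t => t ^+ 2)); exact: level_e.
have -> : E (fun x => h x * (SS N x - SS k x)) =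
    E (fun x => h x * e k x ^+ 2) + E (fun x => h x * (f N x ^+ 2 - f k.+1 x ^+ 2)).
  rewrite (variation_sum variation_f2)// -(@ED N)//; last first.
    by apply: mul => //; apply: (level2 (fun b c => b - c)); apply: SSN.
  by apply: eq_E => x; rewrite /SS (psumS _ k); ring.
rewrite -(@ED N)//; last first.
  apply: mul => //.
  by apply: (level2 (fun b c => b ^+ 2 - c ^+ 2)); apply: fN.
apply: (@E_le N).
- apply: (level2 (fun b c => b + c)) => //; apply: mul => //.
  by apply: (level2 (fun b c => b ^+ 2 - c ^+ 2)); apply: fN.
- by apply: mul => //; exact: (level1 (fun t => 5 * t)).
- move=> x; rewrite -mulrDr ler_wpM2l//.
  have := sqr_f_le x (leqnn N); have := sqr_f_le x (ltnW kN).
  have := sqr_f_le x kN; rewrite /f psumS; set a' := psum e k x; set b' := e k x.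
  have := sqr_ge0 (a' + (a' + b')); have := sqr_ge0 (a' + b').
  set c := psum e N x; set G := F N x; nra.
Qed.

(* The oscillation of [f] after time [k.+1] is controlled by Doob's inequality. *)
Lemma E_F_incr eta k h N : 0 < eta -> (k < N)%N -> level k.+1 h ->
  (forall x, 0 <= h x) ->
  E (fun x => h x * (F N x - F k x)) <=
  E (fun x => h x * (eta * F N x + 10 * eta^-1 * SS N x)).
Proof.
move=> eta0 kN hl h0.
have hN : level N h by exact: level_le kN hl.
have mul u v : level N u -> level N v -> level N (fun x => u x * v x).
  exact: (level2 (fun b c => b * c)).
have FN m : (m <= N)%N -> level N (F m) by move=> mN; exact: level_F.
have SSN := @level_SS _ _ (leqnn N).
(* The martingale sqrt(h) (f - f_(k+1)) after time [k.+1]; the root makes its square carry the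
   weight [h]. *)
pose d i x := if (k < i)%N then Num.sqrt (h x) * e i x else 0.
have dm : mart_incr d.
  split=> [n|n u ul]; rewrite /d; case: (boolP (k < n)%N) => kn //.
  - apply: (@level2 (fun b c => Num.sqrt b * c) _ h (e n)).
      by apply: (level_le _ hl); exact: ltnW.
    exact: level_e.
  - rewrite -(em.2 n (fun x => u x * Num.sqrt (h x))).
      by apply: eq_E => x; rewrite mulrA.
    apply: (@level2 (fun b c => b * Num.sqrt c) _ u h) => //.
    exact: (level_le _ hl).
  - by apply: etrans E0; apply: eq_E => x; rewrite mulr0.
have psum_d m x : (k < m)%N -> psum d m x = Num.sqrt (h x) * (f m x - f k.+1 x).
  elim: m => // m IH; rewrite ltnS leq_eqVlt => /predU1P[<-|km].
    rewrite subrr mulr0 /psum big1// => i _; rewrite /d ifF//.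
    by apply/negbTE; rewrite -leqNgt -ltnS.
  by rewrite psumS IH// /d km /f (psumS e m); ring.
pose M x := runmax (fun i => psum d i x) N ^+ 2.
have Ml : level N M.
  apply: (level1 (fun t => t ^+ 2)).
  by apply: (@level_runmax _ _ (fun x k => psum d k x)) => i iN; exact: level_mart.
have d2N i : (i < N)%N -> level N (fun x => d i x ^+ 2).
  by move=> iN; apply: (level1 (fun t => t ^+ 2)); exact: level_le (dm.1 i).
have EM : E M <= 4 * E (fun x => h x * SS N x).
  apply: (le_trans (doob _ dm)); rewrite ler_pM2l// E_mart_sqr//.
  apply: (@E_le N); [exact: (@level_sum _ _ (fun i x => d i x ^+ 2))|exact: mul|].
  move=> x; rewrite mulr_sumr; apply: ler_sum => i _; rewrite /d.
  case: ifP => _; first by rewrite exprMn sqr_sqrtr.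
  by rewrite expr0n mulr_ge0// sqr_ge0.
have e2N : level N (fun x => e k x ^+ 2).
  by apply: (level1 (fun t => t ^+ 2)); exact: level_e.
have Ee : E (fun x => h x * e k x ^+ 2) <= E (fun x => h x * SS N x).
  apply: (@E_le N); [exact: mul|exact: mul|].
  move=> x; rewrite ler_wpM2l//; apply: le_trans (SS_homo x kN).
  by rewrite /SS psumS lerDr; exact: SS_ge0.
have pt x : h x * (F N x - F k x) <=
    h x * (eta * F N x) + 2 * eta^-1 * (h x * e k x ^+ 2 + M x).
  have M0 : 0 <= M x by exact: sqr_ge0.
  have he : 0 <= h x * e k x ^+ 2 by rewrite mulr_ge0// sqr_ge0.
  have ei : 0 < eta^-1 by rewrite invr_gt0.
  have R0 : 0 <= 2 * eta^-1 * (h x * e k x ^+ 2 + M x).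
    by rewrite mulr_ge0 ?addr_ge0// mulr_ge0// ltW.
  have hF : 0 <= h x * (eta * F N x) by rewrite mulr_ge0// mulr_ge0 ?F_ge0// ltW.
  (* If the maximum is attained by time [k], then F_N = F_k and there is nothing to bound. *)
  have [m mN Fm] := runmax_attained (fun i => f i x) N.
  have FNm : F N x = f m x ^+ 2 by rewrite /F Fm real_normK ?num_real.
  have [mk|km] := leqP m k.
    apply: (@le_trans _ _ 0); last exact: addr_ge0.
    by apply: mulr_ge0_le0 => //; rewrite subr_le0 FNm; exact: sqr_f_le.
  have hM : h x * (f m x - f k.+1 x) ^+ 2 <= M x.
    have <- : psum d m x ^+ 2 = h x * (f m x - f k.+1 x) ^+ 2.
      by rewrite psum_d// exprMn sqr_sqrtr.
    rewrite -[leLHS]real_normK ?num_real// ler_pXn2r ?nnegrE ?runmax_ge0//.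
    exact: (le_runmax (fun i => psum d i x)).
  have Fk := sqr_f_le x (leqnn k); have FkN := F_homo x (ltnW kN).
  (* With y = f_m and z = f_k: (y + z)(y - z) <= eta (y + z)^2 / 4 + (y - z)^2 / eta, and (y + z)^2
     <= 4 F_N. *)
  have key : f m x ^+ 2 - f k x ^+ 2 <= eta * F N x + eta^-1 * (f m x - f k x) ^+ 2.
    rewrite -(ler_pM2l eta0) [leRHS]mulrDr (mulrA eta eta^-1) mulfV ?gt_eqF// mul1r.
    rewrite FNm in FkN *; move: (f m x) (f k x) (F k x) Fk FkN => y z G Fk FkN.
    have : 0 <= (eta * (y + z) - 2 * (y - z)) ^+ 2 by exact: sqr_ge0.
    have : 0 <= (y - z) ^+ 2 by exact: sqr_ge0.
    have : 0 <= eta ^+ 2 * (y ^+ 2 - z ^+ 2).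
      by rewrite mulr_ge0 ?sqr_ge0// subr_ge0 (le_trans Fk).
    have : 0 <= eta ^+ 2 * (y - z) ^+ 2 by rewrite mulr_ge0 ?sqr_ge0.
    nra.
  have split_e : (f m x - f k x) ^+ 2 <= 2 * (e k x ^+ 2 + (f m x - f k.+1 x) ^+ 2).
    rewrite /f (psumS _ k); set y := psum e m x; set z := psum e k x.
    set w := e k x; have := sqr_ge0 (w - (y - (z + w))); nra.
  have : h x * (F N x - F k x) <= h x * (eta * F N x + eta^-1 * (f m x - f k x) ^+ 2).
    by rewrite ler_wpM2l//; move: key; rewrite -FNm; lra.
  move/le_trans; apply; rewrite mulrDr lerD2l mulrCA [2 * _]mulrC -mulrA.
  rewrite ler_pM2l// (le_trans (ler_wpM2l (h0 x) split_e))//.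
  by rewrite mulrCA ler_pM2l// mulrDr lerD2l.
have step : E (fun x => h x * (F N x - F k x)) <=
    E (fun x => h x * (eta * F N x)) +
    2 * eta^-1 * (E (fun x => h x * e k x ^+ 2) + E M).
  have heF : level N (fun x => h x * (eta * F N x)).
    by apply: mul => //; apply: (@level1 (fun t => eta * t) _ (F N)); exact: FN.
  have heM : level N (fun x => h x * e k x ^+ 2 + M x).
    by apply: (level2 (fun b c => b + c)) => //; exact: mul.
  rewrite -(@ED N)//; last exact: mul.
  rewrite -(@EZ N)// -(@ED N)//; last first.
    exact: (@level1 (fun t => 2 * eta^-1 * t)).
  apply: (@E_le N) => //.
  - by apply: mul => //; apply: (level2 (fun b c => b - c)); apply: FN => //; exact: ltnW.
  - apply: (@level2 (fun b c => b + c) N (fun x => h x * (eta * F N x))) => //.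
    exact: (@level1 (fun t => 2 * eta^-1 * t)).
apply: (le_trans step).
have -> : E (fun x => h x * (eta * F N x + 10 * eta^-1 * SS N x)) =
    E (fun x => h x * (eta * F N x)) + 10 * eta^-1 * E (fun x => h x * SS N x).
  rewrite -(@EZ N); last exact: mul.
  rewrite -(@ED N).
  - by apply: eq_E => x; ring.
  - by apply: mul => //; apply: (@level1 (fun t => eta * t) _ (F N)); exact: FN.
  - by apply: (@level1 (fun t => 10 * eta^-1 * t)); exact: mul.
have ei : 0 < eta^-1 by rewrite invr_gt0.
(* 10 = 2 (1 + 4): one share of [SS] for the jump [e k], four from Doob's inequality. *)
rewrite lerD2l [10 * _]mulrC [2 * _]mulrC -!mulrA ler_pM2l//.
by move: Ee EM; set X := E _; set Y := E _; set Y' := E _; lra.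
Qed.

(** In order: absorption, Garsia's lemma, the power of a sum, and 10 / eta = 80 r for eta = 1 / (8
    r). *)
Definition burkholder_cst := 2 * ((2 * r) `^ r * 2 `^ r * (80 * r) `^ r).

Lemma E_F_large N :
  E (fun x => F N x `^ r) <= burkholder_cst * E (fun x => SS N x `^ r).
Proof.
pose eta := (8 * r)^-1.
have eta0 : 0 < eta by rewrite invr_gt0 mulr_gt0.
have FN := @level_F _ _ (leqnn N).
have SSN := @level_SS _ _ (leqnn N).
pose Z x := eta * F N x + 10 * eta^-1 * SS N x.
have Zl : level N Z.
  exact: (@level2 (fun b c => eta * b + 10 * eta^-1 * c) _ (F N) (SS N)).
have ei : 0 <= 10 * eta^-1 by rewrite mulr_ge0// invr_ge0 ltW.
have G : E (fun x => F N x `^ r) <= (2 * r) `^ r * E (fun x => Z x `^ r).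
  apply: (garsia (mu := succn)) => //.
  - by move=> k; exact: level_F.
  - by move=> k; exact: level_F.
  - by move=> x; rewrite addr_ge0// mulr_ge0 ?F_ge0 ?SS_ge0// ltW.
  - by move=> x; rewrite /F /= /f psum0 normr0 expr0n.
  - by move=> k x; exact: F_homo.
  - by move=> k h kN hl h0; exact: E_F_incr.
have EZr : E (fun x => Z x `^ r) <=
   2 `^ r * (eta `^ r * E (fun x => F N x `^ r) +
             (80 * r) `^ r * E (fun x => SS N x `^ r)).
  have Frl : level N (fun x => F N x `^ r) by exact: (level1 (fun t => t `^ r)).
  have SSrl : level N (fun x => SS N x `^ r) by exact: (level1 (fun t => t `^ r)).
  rewrite -!(@EZ N)// -(@ED N).
  - rewrite -(@EZ N); last first.
      exact: (@level2 (fun b c => eta `^ r * b + (80 * r) `^ r * c) N _ _ Frl SSrl).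
    apply: (@E_le N).
    + exact: (level1 (fun t => t `^ r)).
    + exact: (@level2 (fun b c => 2 `^ r * (eta `^ r * b + (80 * r) `^ r * c)) N _ _ Frl SSrl).
    move=> x; rewrite -!powRM ?F_ge0 ?SS_ge0 ?(ltW eta0) ?mulr_ge0 ?(ltW r0)//.
    have -> : 80 * r = 10 * eta^-1 by rewrite /eta invrK; ring.
    apply: powR_add_le; first exact: ltW.
      by rewrite mulr_ge0 ?F_ge0// ltW.
    by rewrite mulr_ge0 ?SS_ge0.
  - exact: (@level1 (fun t => eta `^ r * t) N _ Frl).
  - exact: (@level1 (fun t => (80 * r) `^ r * t) N _ SSrl).
(* This fixes eta: the product is (4 r eta)^r = (1/2)^r, which is at most 1/2 since r >= 1. *)
have absorb : (2 * r) `^ r * (2 `^ r * eta `^ r) <= 2^-1.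
  rewrite -!powRM ?mulr_ge0 ?(ltW r0) ?(ltW eta0)//.
  have -> : 2 * r * (2 * eta) = 2^-1.
    by rewrite /eta; field; rewrite gt_eqF.
  rewrite ge1r_powR//; lra.
have EF0 : 0 <= E (fun x => F N x `^ r) by apply: E_ge0 => x; exact: powR_ge0.
have := le_trans G (ler_wpM2l (powR_ge0 (2 * r) r) EZr).
have := ler_wpM2r EF0 absorb.
rewrite /burkholder_cst; set X := E _; set Y := E _.
set P := (2 * r) `^ r; set Q := 2 `^ r; set S := eta `^ r; set U := (80 * r) `^ r.
nra.
Qed.

End large_exponent.

End one_martingale.

End finite_horizon.

(** * Dyadic intervals and expectations over a unit interval *)

Section dyadic_cells.
Context {R : realType}.

Definition cell (n : nat) (x : R) : int := Num.floor (x * 2 ^+ n).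

Lemma cellP n x k : cell n x = k <-> k%:~R / 2 ^+ n <= x < (k + 1)%:~R / 2 ^+ n.
Proof.
have p0 : 0 < 2 ^+ n :> R by rewrite exprn_gt0.
rewrite ler_pdivrMr// ltr_pdivlMr//.
by split => [<-|/floor_def//]; exact: floor_itv.
Qed.

Lemma cellS n x y : cell n.+1 x = cell n.+1 y -> cell n x = cell n y.
Proof.
move=> H; have bnd z : 2 * cell n z <= cell n.+1 z < 2 * cell n z + 2.
  have /andP[z1 z2] := floor_itv (z * 2 ^+ n).
  rewrite /cell floor_ge_int floor_lt_int exprS mulrCA !(rmorphM, rmorphD)/=.
  by rewrite ler_pM2l// z1/=; move: z2; rewrite rmorphD/=; lra.
by have := bnd x; have := bnd y; rewrite H; lia.
Qed.

Lemma cell_le m n x y : (m <= n)%N -> cell n x = cell n y -> cell m x = cell m y.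
Proof. by move=> mn; rewrite -(subnK mn); elim: (n - m)%N => // k IH /cellS. Qed.

Lemma cell0_bounds n x : cell 0 x * 2 ^+ n <= cell n x < (cell 0 x + 1) * 2 ^+ n.
Proof.
have p0 : 0 < 2 ^+ n :> R by rewrite exprn_gt0.
have /andP[x1 x2] := floor_itv (x * 2 ^+ 0).
rewrite floor_ge_int floor_lt_int !rmorphM/= !rmorphXn/=.
by rewrite ler_pM2r// ltr_pM2r// -[X in _ <= X < _](mulr1 x) x1.
Qed.

(** A unit interval has only 2^n cells of level [n]; this is the source of all boundedness and of
    the finite sums in [mean_cells]. *)
Lemma cell_natE n (x : R) : exists2 i : nat, (i < 2 ^ n)%N &
  cell n x = cell 0 x * 2 ^+ n + i%:Z.
Proof.
have /andP[h1 h2] := cell0_bounds n x.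
pose d : int := (cell n x - cell 0 x * 2 ^+ n)%R; exists (absz d); rewrite /d; first last.
  by rewrite gez0_abs ?subr_ge0// addrC subrK.
rewrite -ltz_nat gez0_abs ?subr_ge0// ltrBlDl.
by rewrite -(natz (2 ^ n)) natrX; move: h2; rewrite mulrDl mul1r.
Qed.

Definition cell_set n k : set R := [set x | cell n x = k].

Lemma dyadic_intervalsE n : dyadic_intervals R n = range (cell_set n).
Proof.
by congr image; apply/funext => k; apply/seteqP; split => x /=;
  rewrite in_itv/= => /cellP.
Qed.

Lemma unit_intervalE j : unit_interval j = cell_set 0 j.
Proof.
by apply/seteqP; split => x; rewrite /unit_interval /cell_set/= in_itv/= => H;
  [apply/cellP|move/cellP: H]; rewrite expr0 !divr1.
Qed.

Definition cell_inv {V : Type} n (h : R -> V) :=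
  forall x y, cell n x = cell n y -> h x = h y.

Lemma cell_invS {V : Type} m n (h : R -> V) : (m <= n)%N -> cell_inv m h -> cell_inv n h.
Proof. by move=> mn H x y /(cell_le mn) /H. Qed.

(** A set is read as a [Prop]-valued function. Invariant sets form a sigma-algebra containing the
    generators; conversely an invariant set is a countable union of cells. *)
Lemma dyadic_sigmaP n A : dyadic_sigma R n A <-> cell_inv n A.
Proof.
split=> [|H].
  move: A; apply: smallest_sub; first split.
  - by move=> x y.
  - by move=> A HA x y xy; rewrite !setTD /setC/= (HA x y xy).
  - move=> F HF x y xy; rewrite propeqE; split=> -[i _ Fi]; exists i => //.
      by rewrite -(HF i x y xy).
    by rewrite (HF i x y xy).
  move=> _ [k _ <-] x y; rewrite propeqE/= !in_itv/= => xy.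
  by split=> /cellP h; apply/cellP; rewrite -h.
have -> : A = \bigcup_(k : int) (cell_set n k `&` A).
  by apply/seteqP; split => [x Ax|x [k _ [_ //]]]; exists (cell n x).
apply: (@countable_bigcupT_measurable _ (dyadic_level R n)) => // k.
have [[x xk Ax]|nA] := pselect (exists2 x, cell n x = k & A x).
  rewrite (_ : _ `&` _ = cell_set n k).
    by apply: sub_sigma_algebra; rewrite dyadic_intervalsE; exists k.
  by apply/seteqP; split => [y []//|y yk]; split => //; rewrite -(H x)// yk.
rewrite (_ : _ `&` _ = set0); first exact: (@measurable0 _ (dyadic_level R n)).
by rewrite -subset0 => y [yk Ay]; apply: nA; exists y.
Qed.

Lemma dyadic_sigma_measurable n A : dyadic_sigma R n A ->
  @measurable _ (dyadic_line R) A.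
Proof. by move=> nA; apply: sub_sigma_algebra; exists n. Qed.

Lemma cell_set_sigma n k : dyadic_sigma R n (cell_set n k).
Proof. by apply/dyadic_sigmaP => x y xy; rewrite /cell_set /= xy. Qed.

Lemma measurable_cell_set n k : @measurable _ (dyadic_line R) (cell_set n k).
Proof. by apply: (@dyadic_sigma_measurable n); exact: cell_set_sigma. Qed.

Lemma cell_inv_measurable d (V : measurableType d) n (h : R -> V) : cell_inv n h ->
  measurable_fun [set: dyadic_level R n] (h : dyadic_level R n -> V).
Proof.
move=> H _ B mB; rewrite setTI; apply/dyadic_sigmaP => x y xy.
by rewrite /preimage/= (H x y xy).
Qed.

Lemma cell_inv_measurable_line d (V : measurableType d) n (h : R -> V) A :
  @measurable _ (dyadic_line R) A ->
  cell_inv n h -> measurable_fun A (h : dyadic_line R -> V).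
Proof.
move=> mA H _ B mB; apply: measurableI => //.
have : dyadic_sigma R n (h @^-1` B).
  by have := cell_inv_measurable H measurableT mB; rewrite setTI.
exact: dyadic_sigma_measurable.
Qed.

Lemma measurable_cell_inv d (V : measurableType d) n (h : R -> V) :
  (forall v : V, measurable [set v]) ->
  measurable_fun [set: dyadic_level R n] (h : dyadic_level R n -> V) -> cell_inv n h.
Proof.
move=> m1 mh x y xy; have := mh measurableT [set h x] (m1 _).
rewrite setTI => /dyadic_sigmaP /(_ _ _ xy); rewrite /preimage/= => hxy.
by have -> : h y = h x by rewrite -hxy.
Qed.

End dyadic_cells.

Lemma bigcup_int_nat {T : Type} (F : int -> set T) :
  \bigcup_k F k = \bigcup_i (if unpickle i is Some k then F k else set0).
Proof.
apply/seteqP; split=> [x [k _ Fk]|x [i _]].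
  by exists (pickle k) => //; rewrite pickleK.
by case: unpickle => // k Fk; exists k.
Qed.

(** * Points outside the null dyadic intervals *)

Section good_points.
Context {R : realType} (P : probability (dyadic_line R) R).

Notation mline := (@measurable _ (dyadic_line R)).

Definition good : set R := [set x | forall n, P (cell_set n (cell n x)) != 0%E].

Lemma good_compl : ~` good =
  \bigcup_n \bigcup_(k : int) (if P (cell_set n k) == 0%E then cell_set n k else set0).
Proof.
apply/seteqP; split=> [x /existsNP[n /negP]|x [n _ [k _]]].
  by rewrite negbK => x0; exists n => //; exists (cell n x) => //; rewrite x0.
by case: eqP => // k0 xk /(_ n); rewrite xk k0 eqxx.
Qed.

Let mF n k : mline (if P (cell_set n k) == 0%E then cell_set n k else set0).
Proof. by case: ifP => _; [exact: measurable_cell_set|exact: measurable0]. Qed.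

Lemma measurable_good : mline good.
Proof.
rewrite -(setCK good); apply: measurableC; rewrite good_compl.
apply: bigcupT_measurable => n; exact: countable_bigcupT_measurable.
Qed.

Lemma good_compl_null : P (~` good) = 0%E.
Proof.
apply: measure_negligible; first exact: (measurableC measurable_good).
rewrite good_compl; apply: negligible_bigcup => n.
rewrite bigcup_int_nat; apply: negligible_bigcup => i.
case: unpickle => [k|]; last exact: negligible_set0.
by apply/negligibleP => //; case: eqP => // _; rewrite measure0.
Qed.

(** If an invariant property fails at a point, it fails on the whole cell, which has positive mass
    around a good point. *)
Lemma ae_good (Q : R -> Prop) n : cell_inv n Q -> {ae P, forall x, Q x} ->
  forall x, good x -> Q x.
Proof.
move=> Qn [B [mB B0 QB]] x gx; apply: contrapT => nQ.
have /negP := gx n; apply; rewrite -measure_le0 -B0.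
apply: le_measure; rewrite ?inE//; first exact: measurable_cell_set.
by move=> y yx; apply: QB => /=; rewrite (Qn y x).
Qed.

Lemma good_ae (Q : R -> Prop) : (forall x, good x -> Q x) -> {ae P, forall x, Q x}.
Proof.
move=> H; exists (~` good); split.
- exact: (measurableC measurable_good).
- exact: good_compl_null.
- by move=> x nQ /H.
Qed.

Lemma cell_inv_bounded n (h : R -> R) j : cell_inv n h ->
  exists M, forall x, cell 0 x = j -> `|h x| <= M.
Proof.
(* The left endpoints represent the cells, and the sum of the absolute values at them bounds the
   largest one. *)
move=> hn; pose y i : R := (j * 2 ^+ n + i%:Z)%:~R / 2 ^+ n.
exists (\sum_(i < 2 ^ n) `|h (y i)|) => x xj.
have [i i2 xi] := cell_natE n x.
rewrite (hn x (y i)); last first.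
  rewrite xi xj; symmetry; apply/cellP; rewrite /y lexx/= ltr_pM2r ?invr_gt0 ?exprn_gt0//.
  by rewrite ltr_int; lia.
by rewrite (bigD1 (Ordinal i2))//= lerDl sumr_ge0.
Qed.

Lemma cell_inv_integrable n (h : R -> R) A j : mline A -> A `<=` cell_set 0 j ->
  cell_inv n h -> P.-integrable A (EFin \o h).
Proof.
move=> mA Aj hn; apply: measurable_bounded_integrable => //.
- by rewrite (le_lt_trans (probability_le1 _ mA))// ltry.
- exact: (cell_inv_measurable_line mA hn).
- have [M hM] := cell_inv_bounded j hn; exists M; split; first exact: num_real.
  by move=> N /ltW MN x Ax; apply: le_trans MN; apply: hM; exact: Aj.
Qed.

Section unit_cell.
Context (j : int).

Definition gunit : set R := good `&` cell_set 0 j.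

Lemma measurable_gunit : mline gunit.
Proof. by apply: measurableI; [exact: measurable_good|exact: measurable_cell_set]. Qed.

(** On this subtype the almost sure relations become relations at every point, as the finite-horizon
    section demands. *)
Definition point := {x : R | gunit x}.

Definition same_cell n (s t : point) := cell n (sval s) = cell n (sval t).

Lemma same_cellS n s t : same_cell n.+1 s t -> same_cell n s t.
Proof. exact: cellS. Qed.

Definition ext (h : point -> R) (x : R) : R :=
  if pselect (gunit x) is left p then h (exist _ x p) else 0.

(** Unlike [ext], this extension is constant on all cells of level [n], bad points included;
    integrability of [ext h] is inherited from it. *)
Definition glob n (h : point -> R) (x : R) : R :=
  if pselect (exists t : point, cell n (sval t) = cell n x) is left e
  then h (projT1 (cid e)) else 0.

Lemma extE h (t : point) : ext h (sval t) = h t.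
Proof.
case: t => x p; rewrite /ext; case: pselect => //= q.
by congr (h (exist _ _ _)); exact: Prop_irrelevance.
Qed.

Lemma globE n h (t : point) : level same_cell n h -> glob n h (sval t) = h t.
Proof.
rewrite /glob => hn; case: pselect => [e|[]]; last by exists t.
by apply: hn; case: cid.
Qed.

Lemma ext_glob n h x : level same_cell n h -> gunit x -> ext h x = glob n h x.
Proof. by move=> hn gx; rewrite (extE h (exist _ x gx)) (globE (exist _ x gx)). Qed.

Lemma ext_sval (g : R -> R) x : gunit x -> ext (fun t => g (sval t)) x = g x.
Proof. by move=> gx; rewrite (extE _ (exist _ x gx)). Qed.

Lemma glob_cell_inv n h : cell_inv n (glob n h).
Proof.
move=> x y xy; rewrite /glob.
rewrite (_ : (fun t : point => _) = (fun t => cell n (sval t) = cell n y))//.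
by apply/funext => t; rewrite xy.
Qed.

Lemma level_sval n (g : R -> R) : cell_inv n g -> level same_cell n (g \o sval).
Proof. by move=> gn s t st; exact: gn. Qed.

(** Not divided by the mass of A_j, which may be 0. *)
Definition mean (h : point -> R) : R := \int[P]_(x in gunit) ext h x.

Lemma ext_integrable n h : level same_cell n h -> P.-integrable gunit (EFin \o ext h).
Proof.
move=> hn; apply: (@eq_integrable _ _ _ _ _ measurable_gunit (EFin \o glob n h)).
  by move=> x; rewrite inE => gx /=; rewrite (ext_glob hn).
by apply: (@cell_inv_integrable n _ _ j measurable_gunit); [move=> x []|exact: glob_cell_inv].
Qed.

Lemma meanD n h g : level same_cell n h -> level same_cell n g ->
  mean (fun x => h x + g x) = mean h + mean g.
Proof.
move=> hn gn; rewrite /mean -RintegralD.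
- by apply: eq_Rintegral => x; rewrite inE => gx;
    rewrite !(extE _ (exist _ x gx : point)).
- exact: measurable_gunit.
- exact: ext_integrable hn.
- exact: ext_integrable gn.
Qed.

Lemma meanZ n c h : level same_cell n h -> mean (fun x => c * h x) = c * mean h.
Proof.
move=> hn; rewrite /mean -RintegralZl.
- by apply: eq_Rintegral => x; rewrite inE => gx;
    rewrite !(extE _ (exist _ x gx : point)).
- exact: measurable_gunit.
- exact: ext_integrable hn.
Qed.

Lemma mean_ge0 h : (forall x, 0 <= h x) -> 0 <= mean h.
Proof. by move=> h0; apply: Rintegral_ge0 => x _; rewrite /ext; case: pselect. Qed.

End unit_cell.

End good_points.

(** * Averages over cells as conditional expectations *)

Section averages.
Context {R : realType} (P : probability (dyadic_line R) R).

Notation mline := (@measurable _ (dyadic_line R)).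

Lemma cell_set_sub0 n (x : R) : @cell_set R n (cell n x) `<=` @cell_set R 0 (cell 0 x).
Proof. by move=> y yx; exact: (cell_le (leq0n n) yx). Qed.

Lemma cell_integrable m n (h : R -> R) (x : R) : cell_inv m h ->
  P.-integrable (cell_set n (cell n x)) (EFin \o h).
Proof.
move=> hm; apply: (cell_inv_integrable (j := cell 0 x) P _ _ hm).
  exact: measurable_cell_set.
exact: cell_set_sub0.
Qed.

(** On a null cell the quotient is 0 by the convention for division by 0; such cells contain no good
    point. *)
Definition avg n (h : R -> R) (x : R) : R :=
  \int[P]_(y in cell_set n (cell n x)) h y / fine (P (cell_set n (cell n x))).

Lemma avg_cell_inv n (h : R -> R) : cell_inv n (avg n h).
Proof. by move=> x y xy; rewrite /avg xy. Qed.

Lemma avg_ge0 n (h : R -> R) (x : R) : (forall y, 0 <= h y) -> 0 <= avg n h x.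
Proof.
move=> h0; apply: divr_ge0; last by rewrite fine_ge0// measure_ge0.
by apply: Rintegral_ge0 => y _; exact: h0.
Qed.

Lemma Rintegral_avg m n (h : R -> R) (x : R) : cell_inv m h ->
  \int[P]_(y in cell_set n (cell n x)) avg n h y =
  \int[P]_(y in cell_set n (cell n x)) h y.
Proof.
move=> hm; rewrite (@eq_Rintegral _ _ _ _ _ (fun=> avg n h x)); last first.
  by move=> y; rewrite inE => yx; apply: avg_cell_inv.
rewrite Rintegral_cst; last exact: measurable_cell_set.
set p := (X in _ * X).
have [p0|p0] := eqVneq p 0; last by rewrite /avg divfK.
have /eqP : P (cell_set n (cell n x)) = 0%E.
  rewrite -[LHS]fineK; first by rewrite -[0%E]/(0%:E); congr EFin.
  by apply: fin_num_measure; exact: measurable_cell_set.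
rewrite p0 mulr0 => /eqP P0; rewrite /Rintegral null_set_integral//.
  exact: measurable_cell_set.
by apply: (cell_inv_measurable_line _ (n := m));
  [exact: measurable_cell_set|move=> y z /hm ->].
Qed.

Lemma integral_avg m n (h : R -> R) (x : R) : cell_inv m h ->
  (\int[P]_(y in cell_set n (cell n x)) (avg n h y)%:E =
   \int[P]_(y in cell_set n (cell n x)) (h y)%:E)%E.
Proof.
move=> hm; have := @Rintegral_avg m n h x hm; rewrite /Rintegral => H.
rewrite -[LHS]fineK; last first.
  by apply: integrable_fin_num; [exact: measurable_cell_set|
    exact: cell_integrable (@avg_cell_inv n h)].
rewrite -[RHS]fineK; last first.
  by apply: integrable_fin_num; [exact: measurable_cell_set|
    exact: cell_integrable hm].
by rewrite H.
Qed.

Lemma integral_avg_level m n (h : R -> R) (A : set R) : (forall y, 0 <= h y) -> cell_inv m h ->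
  dyadic_sigma R n A ->
  (\int[P]_(y in A) (avg n h y)%:E = \int[P]_(y in A) (h y)%:E)%E.
Proof.
move=> h0 hm /dyadic_sigmaP An.
(* Each piece is empty or a whole cell; [pickle] merely indexes the cells by natural numbers. *)
pose F i : set R := [set x | A x /\ pickle (cell n x) = i].
have AF : A = \bigcup_i F i.
  by apply/seteqP; split=> [x Ax|x [i _ []//]]; exists (pickle (cell n x)).
have mF i : mline (F i).
  apply: (@dyadic_sigma_measurable _ n); apply/dyadic_sigmaP => x y xy.
  by rewrite /F/= xy (An x y xy).
have tF : trivIset setT F.
  apply/trivIsetP => i k _ _ /eqP ik; rewrite -subset0 => x [[_ xi] [_ xk]].
  by apply: ik; rewrite -xi -xk.
have mU := bigcupT_measurable _ mF.
rewrite AF !ge0_integral_bigcup//; last 4 first.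
- by apply: (cell_inv_measurable_line mU (n := m)) => x y /hm ->.
- by move=> x _; rewrite lee_fin.
- by apply: (cell_inv_measurable_line mU (n := n)) => x y /(avg_cell_inv h) ->.
- by move=> x _; rewrite lee_fin avg_ge0.
apply: eq_eseriesr => i _.
have [->|/set0P[x [Ax xi]]] := eqVneq (F i) set0; first by rewrite !integral_set0.
suff -> : F i = cell_set n (cell n x) by exact: integral_avg hm.
apply/seteqP; split=> y; first by case=> _; rewrite -xi => /(pcan_inj pickleK).
by move=> yx; split; [rewrite (An y x)|rewrite -xi yx].
Qed.

(** The average witnesses that a version exists, so [xget] does not fall back on its default. *)
Lemma condexp_spec m n (h : R -> R) : (forall y, 0 <= h y) -> cell_inv m h ->
  (forall x, 0 <= condexp P n (EFin \o h) x)%E /\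
  is_condexp P n (EFin \o h) (condexp P n (EFin \o h)).
Proof.
move=> h0 hm; rewrite /condexp; set S := [set g | _].
suff : S (xget (cst 0%E) S) by [].
apply: (xgetPex (cst 0%E)); exists (EFin \o avg n h); split.
  by move=> y; rewrite lee_fin avg_ge0.
split; last by move=> A nA; exact: (integral_avg_level h0 hm nA).
by apply: cell_inv_measurable => y z /(avg_cell_inv h) yz; rewrite /= yz.
Qed.

Lemma condexp_cell_inv m n (h : R -> R) : (forall y, 0 <= h y) -> cell_inv m h ->
  cell_inv n (condexp P n (EFin \o h)).
Proof.
move=> h0 hm; have [_ [mg _]] := condexp_spec n h0 hm.
by apply: measurable_cell_inv mg => v; exact: emeasurable_set1.
Qed.

(** The version picked by [xget] is unknown, but it is constant on the cell of [x] with the same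
    integral as the average, and the mass is positive; this also excludes the value +oo. *)
Lemma condexp_avg m n (h : R -> R) (x : R) : (forall y, 0 <= h y) -> cell_inv m h ->
  good P x -> condexp P n (EFin \o h) x = (avg n h x)%:E.
Proof.
move=> h0 hm gx; have gn := condexp_cell_inv (n := n) h0 hm.
have [] := condexp_spec n h0 hm; set g := condexp _ _ _ in gn * => g0 [mg gA].
have := gA _ (@cell_set_sigma R n (cell n x)).
rewrite -(integral_avg n x hm).
have mC := measurable_cell_set (R := R) n (cell n x).
rewrite (@eq_integral _ _ _ _ _ (cst (g x))); last first.
  by move=> y; rewrite inE => /gn ->.
rewrite [RHS](@eq_integral _ _ _ _ _ (cst (avg n h x)%:E)); last first.
  by move=> y; rewrite inE => yx /=; rewrite (avg_cell_inv h yx).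
rewrite !integral_cst//; set p := (X in (_ * X)%E).
rewrite [X in _ = (_ * X)%E](_ : _ = p)//.
have p0 : p != 0%E := gx n.
have pf : p \is a fin_num by exact: fin_num_measure.
rewrite -(fineK pf); have fp : fine p != 0 by rewrite fine_eq0.
have fp0 : 0 < fine p by rewrite lt_def fp fine_ge0// measure_ge0.
move: (g0 x); case: (g x) => [r _|_|//]; last by rewrite gt0_mulye ?lte_fin// -EFinM.
by rewrite -!EFinM => -[/(mulIf fp) ->].
Qed.

End averages.

Section conditional_means.
Context {R : realType} (P : probability (dyadic_line R) R) (j : int).

Notation mline := (@measurable _ (dyadic_line R)).
Notation point := (point P j).
Notation mean := (@mean R P j).
Notation level := (@level R point (@same_cell R P j)).
Notation gunit := (gunit P j).

Lemma mean_ind m n (g : R -> R) (t : point) : cell_inv m g ->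
  mean (fun s => (cell n (sval s) == cell n (sval t))%:R * g (sval s)) =
  \int[P]_(x in cell_set n (cell n (sval t))) g x.
Proof.
move=> gm; set A := cell_set _ _.
have mA : mline A by exact: measurable_cell_set.
have Aj : A `<=` cell_set 0 j.
  have tj : cell 0 (sval t) = j := (svalP t).2.
  by move=> x Ax; rewrite /cell_set/= -tj; exact: (cell_set_sub0 Ax).
have -> : mean (fun s => (cell n (sval s) == cell n (sval t))%:R * g (sval s)) =
    \int[P]_(x in gunit `&` A) g x.
  rewrite /mean [RHS]Rintegral_mkcondr; apply: eq_Rintegral => x; rewrite inE => gx.
  rewrite (extE _ (exist _ x gx : point))/= patchE.
  by case: eqP => xt; [rewrite mul1r mem_set|rewrite mul0r memNset].
(* The cell and its part in [gunit] differ by bad points, a null set. *)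
rewrite /Rintegral; congr fine.
have negl := @negligible_integral _ (dyadic_line R) R P A (~` good P) (EFin \o g)
  (measurableC (measurable_good P)) mA (cell_inv_integrable P mA Aj gm)
  (good_compl_null P).
symmetry; apply: etrans negl _; congr integral; apply/seteqP; split=> x.
  by case=> Ax /contrapT gx; split=> //; split => //; exact: Aj.
by case=> -[gx _] Ax; split.
Qed.

(* On [point] a level-[n] function is a finite combination of indicators of
   dyadic intervals, so orthogonality may be tested on those intervals. *)
Lemma mean_cells m n (u g : point -> R) : (n <= m)%N -> level n u -> level m g ->
  (forall t : point,
     mean (fun s => (cell n (sval s) == cell n (sval t))%:R * g s) = 0) ->
  mean (fun s => u s * g s) = 0.
Proof.
move=> nm ul gl H.
pose k (i : nat) : int := (j * 2 ^+ n + i%:Z)%R.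
(* The value of [u] on the cell [k i]; a cell without points of [point] never enters, so the default
   0 is harmless. *)
pose c i := if pselect (exists t : point, cell n (sval t) = k i) is left e
  then u (projT1 (cid e)) else 0.
have indl i : level m (fun s => (cell n (sval s) == k i)%:R).
  by move=> s t st; rewrite (cell_le nm st).
have ugE s : u s * g s = \sum_(i < 2 ^ n) c i * ((cell n (sval s) == k i)%:R * g s).
  case: s => x [gx xj]; have [i i2 xi] := cell_natE n x.
  rewrite (bigD1 (Ordinal i2))//= big1 => [|i' /eqP ii'].
    have xk : cell n x = k i by rewrite xi xj.
    rewrite /= xk eqxx mul1r addr0; congr (_ * _); rewrite /c.
    case: pselect => [e|[]]; last by exists (exist _ x (conj gx xj)).
    by apply: ul; case: cid => t /= tk; rewrite /same_cell/= tk xk.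
  rewrite /= xi xj (_ : (_ == k i') = false) ?mul0r ?mulr0//.
  apply/negbTE/eqP => /addrI [] ii; apply: ii'; exact/val_inj.
have cl i : level m (fun s => (cell n (sval s) == k i)%:R * g s).
  by apply: (@level2 _ _ _ (fun b c => b * c)).
rewrite (eq_E mean ugE).
rewrite (@E_sum _ _ (@same_cell R P j) mean (@meanD R P j) (@meanZ R P j) m _
  (fun i s => c i * ((cell n (sval s) == k i)%:R * g s))); last first.
  by move=> i _; apply: (@level1 _ _ _ (fun t => c i * t)).
rewrite big1// => i _; rewrite (@meanZ _ _ _ m)// /c.
case: pselect => [e|_]; last by rewrite mul0r.
by case: (cid e) => t /= tk; rewrite -tk H mulr0.
Qed.

Lemma mean_mart (f : nat -> R -> R) n (u : point -> R) : is_martingale P f ->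
  level n u -> mean (fun s => u s * (f n.+1 (sval s) - f n (sval s))) = 0.
Proof.
move=> [fa fi fm] ul.
have fc i : cell_inv i (f i).
  by apply: measurable_cell_inv (fa i) => v; exact: measurable_set1.
have fc' : cell_inv n.+1 (f n) by exact: cell_invS (fc n).
have dc : cell_inv n.+1 (fun x => f n.+1 x - f n x).
  by move=> x y xy; rewrite (fc n.+1 _ _ xy) (fc' _ _ xy).
apply: (@mean_cells n.+1 n _ (fun s => f n.+1 (sval s) - f n (sval s))) => //.
  exact: (@level_sval _ _ _ _ (fun x => f n.+1 x - f n x)).
move=> t; rewrite (mean_ind n t dc).
have mA : mline (cell_set n (cell n (sval t))) by exact: measurable_cell_set.
rewrite RintegralB//.
- have [_ /(_ _ (@cell_set_sigma R n (cell n (sval t))))] := fm n.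
  by rewrite /Rintegral => ->; rewrite subrr.
- exact: cell_integrable (fc n.+1).
- exact: cell_integrable fc'.
Qed.

Lemma mean_avg m n (h : R -> R) (u : point -> R) : (n <= m)%N -> cell_inv m h ->
  level n u ->
  mean (fun s => u s * avg P n h (sval s)) = mean (fun s => u s * h (sval s)).
Proof.
move=> nm hm ul; apply/eqP; rewrite -subr_eq0; apply/eqP.
have ac : cell_inv m (avg P n h) by exact: cell_invS (@avg_cell_inv _ P n h).
have um : level m u by exact: (level_le (@same_cellS R P j) nm).
have mul (g : R -> R) : cell_inv m g -> level m (fun s => u s * g (sval s)).
  by move=> gm; apply: (@level2 _ _ _ (fun b c => b * c)) => //; exact: level_sval.
rewrite -(@EB _ _ (@same_cell R P j) mean (@meanD R P j) (@meanZ R P j) m); last 2 first.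
- exact: mul.
- exact: mul.
have dc : cell_inv m (fun x => avg P n h x - h x).
  by move=> x y xy; rewrite (ac _ _ xy) (hm _ _ xy).
rewrite (eq_E mean (g := fun s => u s * (avg P n h (sval s) - h (sval s)))); last first.
  by move=> s; rewrite mulrBr.
apply: (@mean_cells m n _ (fun s => avg P n h (sval s) - h (sval s))) => //.
  exact: (@level_sval _ _ _ _ (fun x => avg P n h x - h x)).
move=> t; rewrite (mean_ind n t dc).
have mA : mline (cell_set n (cell n (sval t))) by exact: measurable_cell_set.
rewrite RintegralB//.
- by rewrite (Rintegral_avg P n (sval t) hm) subrr.
- exact: cell_integrable ac.
- exact: cell_integrable hm.
Qed.

End conditional_means.

(** * Amalgam norms and monotone limits *)

Section powers.
Context {R : realType}.
Local Open Scope ereal_scope.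

Lemma le_poweR (r : R) (x y : \bar R) : (0 <= r)%R -> 0 <= x -> x <= y ->
  x `^ r <= y `^ r.
Proof.
move=> r0 x0 xy; apply: gt0_ler_poweR => //; rewrite in_itv/= leey andbT//.
exact: le_trans xy.
Qed.

Lemma poweRK (r : R) (x : \bar R) : (0 < r)%R -> 0 <= x -> (x `^ r) `^ r^-1 = x.
Proof. by move=> r0 x0; rewrite -poweRrM mulfV ?gt_eqF// poweRe1. Qed.

Lemma poweR_sup (r : R) (y : nat -> \bar R) : (0 < r)%R -> (forall n, 0 <= y n) ->
  ereal_sup (range y) `^ r = ereal_sup (range (fun n => y n `^ r)).
Proof.
move=> r0 y0; have ri0 : (0 < r^-1)%R by rewrite invr_gt0.
have s0 : 0 <= ereal_sup (range y).
  by apply: le_trans (y0 0%N) _; apply: ereal_sup_ubound; exists 0%N.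
have S0 : 0 <= ereal_sup (range (fun n => y n `^ r)).
  apply: le_trans (poweR_ge0 (y 0%N) r) _.
  by apply: ereal_sup_ubound; exists 0%N.
apply/eqP; rewrite eq_le; apply/andP; split; last first.
  apply: ge_ereal_sup => _ [n _ <-]; apply: le_poweR => //; first exact: ltW.
  by apply: ereal_sup_ubound; exists n.
rewrite -[leRHS](poweRK ri0)// invrK; apply: le_poweR => //; first exact: ltW.
apply: ge_ereal_sup => _ [n _ <-]; rewrite -[leLHS](poweRK r0)//.
apply: le_poweR; [exact: ltW|exact: poweR_ge0|].
by apply: ereal_sup_ubound; exists n.
Qed.

Lemma esum_le_scale (T : choiceType) (a b : T -> \bar R) (c : R) : (0 <= c)%R ->
  (forall i, 0 <= b i) -> (forall i, a i <= c%:E * b i) ->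
  \esum_(i in [set: T]) a i <= c%:E * \esum_(i in [set: T]) b i.
Proof.
move=> c0 b0 ab; apply: ge_ereal_sup => _ [A fA <-].
apply: (@le_trans _ _ (c%:E * \sum_(i \in A) b i)); last first.
  by rewrite lee_wpmul2l ?lee_fin//; apply: ereal_sup_ubound; exists A.
rewrite ge0_mule_fsumr//; apply: lee_fsum => //.
by case: fA.
Qed.

(** For q = r finite each interval contributes the factor K^(r/p), and the outer power 1/r turns it
    into K^(1/p); so the constant does not depend on q. *)
Lemma amalgam_norm_le (P : probability (dyadic_line R) R) (p : R) (q : \bar R)
    (K : R) (f g : R -> \bar R) : (0 < p)%R -> 0 < q -> (0 < K)%R ->
  (forall j, \int[P]_(x in unit_interval j) (`|f x| `^ p) <=
     K%:E * \int[P]_(x in unit_interval j) (`|g x| `^ p)) ->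
  amalgam_norm P p q f <= (K `^ p^-1)%:E * amalgam_norm P p q g.
Proof.
move=> p0 q0 K0 H.
have pi0 : (0 <= p^-1)%R by rewrite invr_ge0 ltW.
have I0 (h : R -> \bar R) j : 0 <= \int[P]_(x in unit_interval j) (`|h x| `^ p).
  by apply: integral_ge0 => x _; exact: poweR_ge0.
have Hs (s : R) j : (0 <= s)%R ->
    (\int[P]_(x in unit_interval j) (`|f x| `^ p)) `^ s <=
    (K `^ s)%:E * (\int[P]_(x in unit_interval j) (`|g x| `^ p)) `^ s.
  move=> s0; rewrite -poweR_EFin -poweRM ?lee_fin ?(ltW K0)//.
  exact: le_poweR.
case: q q0 => [r r0|_|//] /=; last first.
  apply: ge_ereal_sup => _ [j _ <-]; apply: le_trans (Hs _ j pi0) _.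
  rewrite lee_wpmul2l ?lee_fin ?powR_ge0//.
  by apply: ereal_sup_ubound; exists j.
rewrite lte_fin in r0; have rp0 : (0 <= r / p)%R by rewrite divr_ge0// ltW.
have -> : (K `^ p^-1)%R = ((K `^ (r / p)) `^ r^-1)%R.
  by rewrite -powRrM mulrAC mulfV ?gt_eqF// mul1r.
rewrite -poweR_EFin -poweRM ?lee_fin ?powR_ge0//; last first.
  by apply: esum_ge0 => j _; exact: poweR_ge0.
apply: le_poweR; first by rewrite invr_ge0 ltW.
  by apply: esum_ge0 => j _; exact: poweR_ge0.
apply: esum_le_scale => [|j|j]; [exact: powR_ge0|exact: poweR_ge0|exact: Hs].
Qed.

End powers.

(** * From truncated processes to their limits *)

Section monotone_limits.
Context {R : realType} (P : probability (dyadic_line R) R) (p : R) (p0 : 0 < p).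

Notation mline := (@measurable _ (dyadic_line R)).

(* [X n] is the square of the process at time [n], hence the exponent [p / 2]. *)
Record square_limit (X : nat -> R -> R) (Xi : R -> \bar R) : Prop := SquareLimit {
  square_limit_ge0 : forall n x, 0 <= X n x;
  square_limit_inv : forall n, cell_inv n (X n);
  square_limit_nd : forall n x, good P x -> X n x <= X n.+1 x;
  square_limit_meas : measurable_fun [set: dyadic_line R] (Xi : dyadic_line R -> \bar R);
  square_limitE : forall x, good P x ->
    (`|Xi x| `^ p = ereal_sup (range (fun n => (X n x `^ (p / 2))%:E)))%E }.

Definition pmean j (X : R -> R) : R := mean (fun t : point P j => X (sval t) `^ (p / 2)).

Lemma pmeanE j n (X : R -> R) : (forall x, 0 <= X x) -> cell_inv n X ->
  (pmean j X)%:E = (\int[P]_(x in gunit P j) (X x `^ (p / 2))%:E)%E.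
Proof.
move=> X0 Xn; have Xpn : cell_inv n (fun x => X x `^ (p / 2)).
  by move=> x y xy; rewrite (Xn _ _ xy).
rewrite /pmean /mean /Rintegral fineK.
  apply: eq_integral => x; rewrite inE => gx; congr EFin.
  exact: (@ext_sval _ P j (fun y => X y `^ (p / 2))).
apply: integrable_fin_num; first exact: measurable_gunit.
apply: (@ext_integrable _ P j n).
exact: (@level_sval _ _ _ _ (fun x => X x `^ (p / 2))).
Qed.

(** Monotone convergence on the good points of A_j; the bad ones do not affect the integral. *)
Lemma integral_square_limit X Xi j : square_limit X Xi ->
  (\int[P]_(x in unit_interval j) (`|Xi x| `^ p) =
   ereal_sup (range (fun n => (pmean j (X n))%:E)))%E.
Proof.
move=> [X0 Xn Xnd Xm XE].
have mg := measurable_gunit P j.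
have mU : mline (unit_interval j).
  by rewrite unit_intervalE; exact: measurable_cell_set.
have mXp A : mline A -> measurable_fun A ((fun x => `|Xi x| `^ p)%E : dyadic_line R -> \bar R).
  move=> mA; apply: measurable_funTS.
  apply: (measurableT_comp (measurable_poweR p)).
  exact: (measurableT_comp (@abse_measurable R setT) Xm).
have negl := @ge0_negligible_integral _ (dyadic_line R) R P (unit_interval j)
  (~` good P) (fun x => `|Xi x| `^ p)%E (measurableC (measurable_good P)) mU (mXp _ mU)
  (fun x _ => poweR_ge0 _ _) (good_compl_null P).
apply: (etrans negl).
have -> : unit_interval j `\` ~` good P = gunit P j.
  by rewrite setDE setCK setIC unit_intervalE.
pose g n (x : dyadic_line R) := (X n x `^ (p / 2))%:E.
have gnd x : gunit P j x -> {homo g ^~ x : m n / (m <= n)%N >-> (m <= n)%E}.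
  move=> [gx _]; apply: (@homo_leq _ (g ^~ x) (fun a b => (a <= b)%E)) => //.
    by move=> b a c; exact: le_trans.
  move=> n; rewrite lee_fin; apply: ge0_ler_powR; rewrite ?nnegrE//.
    by rewrite divr_ge0// ltW.
  exact: Xnd.
have -> : (\int[P]_(x in gunit P j) (`|Xi x| `^ p) =
           \int[P]_(x in gunit P j) limn (g ^~ x))%E.
  apply: eq_integral => x; rewrite inE => gx; rewrite XE; last by case: gx.
  by symmetry; apply/cvg_lim => //; apply: ereal_nondecreasing_cvgn; exact: gnd.
have gm n : @measurable_fun _ _ (dyadic_line R) _ (gunit P j) (g n).
  have gn : cell_inv n (g n) by move=> x y xy; rewrite /g (Xn n x y xy).
  exact: (cell_inv_measurable_line mg gn).
have g0 n x : gunit P j x -> (0 <= g n x)%E by rewrite lee_fin powR_ge0.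
rewrite (monotone_convergence P mg gm g0 gnd).
rewrite (_ : (fun n => _) = (fun n => (pmean j (X n))%:E)); last first.
  by apply/funext => n; rewrite (pmeanE j (n := n)).
apply/cvg_lim => //; apply: ereal_nondecreasing_cvgn.
move=> m n mn; rewrite (@pmeanE _ m (X m))// (@pmeanE _ n (X n))//.
apply: ge0_le_integral => //; [exact: g0|exact: (gm m)|exact: (gm n)|].
by move=> x gx; exact: (gnd x gx m n mn).
Qed.

Lemma amalgam_limit_le X Y Xi Yi q K : (0 < q)%E -> 0 < K ->
  square_limit X Xi -> square_limit Y Yi ->
  (forall j n, exists m, pmean j (X n) <= K * pmean j (Y m)) ->
  (amalgam_norm P p q Xi <= (K `^ p^-1)%:E * amalgam_norm P p q Yi)%E.
Proof.
move=> q0 K0 XL YL H; apply: amalgam_norm_le => // j.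
rewrite (integral_square_limit _ XL) (integral_square_limit _ YL).
apply: ge_ereal_sup => _ [n _ <-]; have [m Hm] := H j n.
apply: (@le_trans _ _ (K%:E * (pmean j (Y m))%:E)%E).
  by rewrite -EFinM lee_fin.
rewrite lee_wpmul2l ?lee_fin ?(ltW K0)//.
by apply: ereal_sup_ubound; exists m.
Qed.

End monotone_limits.

(** * The processes of the Hardy spaces *)

Section processes.
Context {R : realType} (P : probability (dyadic_line R) R) (p : R) (p0 : 0 < p).

Lemma sqr_powR_half (t : R) : 0 <= t -> (t ^+ 2) `^ (p / 2) = t `^ p.
Proof.
move=> t0; rewrite -powR_mulrn// -powRrM mulrCA mulfV ?mulr1// pnatr_eq0.
Qed.

Lemma measurable_sup (Y : nat -> R -> \bar R) :
  (forall n, @measurable_fun _ _ (dyadic_line R) _ setT (Y n)) ->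
  (forall n x, Y n x <= Y n.+1 x)%E ->
  @measurable_fun _ _ (dyadic_line R) _ setT
    (fun x => ereal_sup (range (fun n => Y n x))).
Proof.
move=> mY ndY; apply: (@emeasurable_fun_cvg _ (dyadic_line R) R setT Y _ mY) => x _.
apply: ereal_nondecreasing_cvgn.
by apply/nondecreasing_seqP => n.
Qed.

Lemma sqrteE (x : \bar R) : (0 <= x)%E -> sqrte x = (x `^ 2^-1)%E.
Proof. by move=> x0; rewrite poweR12_sqrt. Qed.

Lemma norm_sqrte_powR (x : \bar R) : (0 <= x)%E ->
  (`|sqrte x| `^ p = x `^ (p / 2))%E.
Proof.
by move=> x0; rewrite gee0_abs ?sqrte_ge0// sqrteE// -poweRrM mulrC.
Qed.

Lemma eseries_sup (u : nat -> R) : (forall n, 0 <= u n) ->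
  (\sum_(0 <= i <oo) (if i is m.+1 then (u m)%:E else 0%:E) =
   ereal_sup (range (fun n => (\sum_(i < n) u i)%:E)))%E.
Proof.
(* The series starts with a vanishing term of index 0, hence the shift by one. *)
move=> u0; apply/cvg_lim => //; rewrite -cvg_shiftS.
rewrite [X in X @ _](_ : _ = (fun n => (\sum_(i < n) u i)%:E)); last first.
  by apply/funext => n /=; rewrite big_nat_recl// add0e -sumEFin big_mkord.
apply: ereal_nondecreasing_cvgn; apply/nondecreasing_seqP => n.
by rewrite lee_fin big_ord_recr/= lerDl.
Qed.

Section one_process.
Context (f : nat -> R -> R) (fM : martingales0 P f).

Definition Fsq n x : R := runmax (fun k => f k x) n ^+ 2.
Definition Ssq n x : R := \sum_(i < n) mart_diff f i.+1 x ^+ 2.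
(** The averages replace the versions chosen by [condexp], with which they agree at good points. *)
Definition ssq n x : R := \sum_(i < n) avg P i (fun y => mart_diff f i.+1 y ^+ 2) x.

Lemma f_cell_inv n : cell_inv n (f n).
Proof.
have [[fa _ _] _] := fM.
by apply: measurable_cell_inv (fa n) => v; exact: measurable_set1.
Qed.

Lemma mart_diff_cell_inv n : cell_inv n.+1 (mart_diff f n.+1).
Proof.
by move=> x y xy; rewrite /= (f_cell_inv xy) (f_cell_inv (cellS xy)).
Qed.

Lemma mart_diff2_cell_inv n : cell_inv n.+1 (fun x => mart_diff f n.+1 x ^+ 2).
Proof. by move=> x y xy; rewrite (mart_diff_cell_inv xy). Qed.

Lemma f0_good x : good P x -> f 0%N x = 0.
Proof.
have [_ f0] := fM; apply: (ae_good (n := 0) _ f0) => {}x y xy.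
by rewrite (f_cell_inv xy).
Qed.

Lemma limit_Fsq : square_limit P p Fsq (maximal_fun f).
Proof.
have FE x : maximal_fun f x =
    ereal_sup (range (fun n => (runmax (fun k => f k x) n)%:E)).
  apply/eqP; rewrite eq_le; apply/andP; split; apply: ge_ereal_sup => _ [n _ <-].
    apply: (@le_trans _ _ (runmax (fun k => f k x) n)%:E).
      by rewrite lee_fin (le_runmax (fun k => f k x)).
    by apply: ereal_sup_ubound; exists n.
  have [m _ ->] := runmax_attained (fun k => f k x) n.
  by apply: ereal_sup_ubound; exists m.
have rn n : cell_inv n (fun x => runmax (fun k => f k x) n).
  move=> x y xy; apply: eq_runmax => m mn.
  by rewrite (f_cell_inv (cell_le mn xy)).
split.
- by move=> n x; exact: sqr_ge0.
- by move=> n x y xy; rewrite /Fsq (rn _ _ _ xy).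
- by move=> n x _; rewrite /Fsq ler_pXn2r ?nnegrE ?runmax_ge0// runmaxS.
- rewrite (_ : maximal_fun f = fun x =>
      ereal_sup (range (fun n => (runmax (fun k => f k x) n)%:E))); last first.
    by apply/funext => x; exact: FE.
  apply: measurable_sup => [n|n x]; last by rewrite lee_fin runmaxS.
  apply/measurable_EFinP.
  by apply: cell_inv_measurable_line (rn n); exact: measurableT.
move=> x gx; rewrite gee0_abs; last first.
  apply: (@le_trans _ _ (`|f 0%N x|%:E)%E); first by rewrite lee_fin.
  by apply: ereal_sup_ubound; exists 0%N.
rewrite FE poweR_sup//; last by move=> n; rewrite lee_fin runmax_ge0.
congr ereal_sup; congr image; apply/funext => n.
by rewrite /Fsq sqr_powR_half ?runmax_ge0// poweR_EFin.
Qed.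

Lemma limit_sqrte_series (u : nat -> R -> R) (Y : R -> \bar R) :
  (forall n x, 0 <= u n x) -> (forall n, cell_inv n.+1 (u n)) ->
  @measurable_fun _ _ (dyadic_line R) _ setT Y -> (forall x, 0 <= Y x)%E ->
  (forall x, good P x ->
     (Y x = \sum_(0 <= i <oo) (if i is m.+1 then (u m x)%:E else 0%:E))%E) ->
  square_limit P p (fun n x => \sum_(i < n) u i x) (fun x => sqrte (Y x)).
Proof.
move=> u0 un mY Y0 YE; split.
- by move=> n x; apply: sumr_ge0.
- move=> n x y xy; apply: eq_bigr => i _; apply: un.
  exact: cell_le xy.
- by move=> n x _; rewrite big_ord_recr/= lerDl.
- rewrite (_ : (fun x => _) = (fun x => (Y x `^ 2^-1)%E)); last first.
    by apply/funext => x; rewrite sqrteE.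
  exact: (measurableT_comp (measurable_poweR _)).
move=> x gx; rewrite norm_sqrte_powR// YE// eseries_sup//.
rewrite poweR_sup ?divr_gt0// => n.
by rewrite lee_fin sumr_ge0.
Qed.

Lemma limit_Ssq : square_limit P p Ssq (square_fun f).
Proof.
have E i x : ((`|mart_diff f i x| ^+ 2)%:E =
    if i is m.+1 then (mart_diff f m.+1 x ^+ 2)%:E else 0%:E)%E.
  case: i => [|i]; first by rewrite normr0 expr0n.
  by rewrite real_normK ?num_real.
have d0 i x : (0 <= (`|mart_diff f i x| ^+ 2)%:E)%E by rewrite lee_fin sqr_ge0.
apply: (@limit_sqrte_series (fun n x => mart_diff f n.+1 x ^+ 2)
  (fun x => \sum_(0 <= i <oo) (`|mart_diff f i x| ^+ 2)%:E)%E).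
- by move=> n x; exact: sqr_ge0.
- exact: mart_diff2_cell_inv.
- apply: ge0_emeasurable_sum => [k x _ _|k _]; first exact: d0.
  rewrite (_ : (fun x => _) = EFin \o
    (fun x => if k is m.+1 then mart_diff f m.+1 x ^+ 2 else 0)); last first.
    by apply/funext => x; rewrite E; case: (k).
  apply/measurable_EFinP; case: k => [|k]; first exact: measurable_cst.
  by apply: cell_inv_measurable_line (@mart_diff2_cell_inv k); exact: measurableT.
- by move=> x; apply: nneseries_ge0.
- by move=> x _; apply: eq_eseriesr => i _; exact: E.
Qed.

Lemma limit_ssq : square_limit P p ssq (cond_square_fun P f).
Proof.
pose h i (x : R) : R := mart_diff f i.+1 x ^+ 2.
have h0 i x : 0 <= h i x by exact: sqr_ge0.
have hc i : cell_inv i.+1 (h i) by exact: mart_diff2_cell_inv.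
have E : cond_square_fun P f = fun x => sqrte (\sum_(0 <= i <oo)
    (if i is m.+1 then condexp P m (EFin \o h m) x else 0))%E.
  apply/funext => x; congr sqrte; apply: eq_eseriesr => -[//|i] _.
  congr (condexp _ _ _ _); apply/funext => y.
  by rewrite /= real_normK ?num_real.
have c0 i x : (0 <= if i is m.+1 then condexp P m (EFin \o h m) x else 0)%E.
  by case: i => // i; have [] := condexp_spec P i (h0 i) (hc i).
rewrite E; apply: (@limit_sqrte_series (fun n => avg P n (h n))).
- by move=> n x; exact: avg_ge0.
- by move=> n; apply: (cell_invS (leqnSn n)); exact: avg_cell_inv.
- apply: ge0_emeasurable_sum => [k x _ _|k _]; first exact: c0.
  case: k => [|k]; first exact: measurable_cst.
  have := @condexp_cell_inv R P k.+1 k (h k) (h0 k) (hc k).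
  by apply: cell_inv_measurable_line; exact: measurableT.
- by move=> x; apply: nneseries_ge0.
- move=> x gx; apply: eq_eseriesr => -[//|i] _.
  exact: condexp_avg (hc i) gx.
Qed.

End one_process.

Section control.
Context (rho : nat -> R -> R) (rhoC : control_sequences rho).

(* [rho] shifted by one step, because [rho n] controls the process at time [n.+1]. *)
Definition rsq n x : R := if n is m.+1 then rho m x ^+ 2 else 0.

Lemma rho_cell_inv n : cell_inv n (rho n).
Proof.
have [ra _ _] := rhoC.
by apply: measurable_cell_inv (ra n) => v; exact: measurable_set1.
Qed.

Lemma limit_rsq : square_limit P p rsq (control_limit rho).
Proof.
have [_ rnd r0] := rhoC.
have CE x : control_limit rho x = ereal_sup (range (fun n => (rho n x)%:E)).
  apply/cvg_lim => //; apply: ereal_nondecreasing_cvgn.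
  by apply/nondecreasing_seqP => n; rewrite lee_fin.
split.
- by case=> [|n] x //=; exact: sqr_ge0.
- by case=> [|n] x y xy //=; rewrite (rho_cell_inv (cellS xy)).
- case=> [|n] x _ /=; first exact: sqr_ge0.
  by rewrite ler_pXn2r ?nnegrE.
- rewrite (_ : control_limit rho = fun x =>
      ereal_sup (range (fun n => (rho n x)%:E))); last exact/funext.
  apply: measurable_sup => [n|n x]; last by rewrite lee_fin.
  apply/measurable_EFinP.
  by apply: cell_inv_measurable_line (@rho_cell_inv n); exact: measurableT.
move=> x gx; rewrite CE gee0_abs; last first.
  apply: (@le_trans _ _ (rho 0%N x)%:E%E); first by rewrite lee_fin.
  by apply: ereal_sup_ubound; exists 0%N.
rewrite poweR_sup//; last by move=> n; rewrite lee_fin.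
apply/eqP; rewrite eq_le; apply/andP; split; apply: ge_ereal_sup => _ [n _ <-].
  by apply: ereal_sup_ubound; exists n.+1 => //=; rewrite sqr_powR_half.
(* The shift adds the value 0 at index 0, which does not change the supremum. *)
case: n => [|n] /=.
  rewrite powR0 ?gt_eqF ?divr_gt0//; apply: (@le_trans _ _ ((rho 0%N x)%:E `^ p)%E).
    exact: poweR_ge0.
  by apply: ereal_sup_ubound; exists 0%N.
by apply: ereal_sup_ubound; exists n => //; rewrite sqr_powR_half.
Qed.

End control.

End processes.

(** * Moment inequalities over one unit interval *)

Section unit_inequalities.
Context {R : realType} (P : probability (dyadic_line R) R) (p : R) (p0 : 0 < p).
Context (f : nat -> R -> R) (fM : martingales0 P f) (j : int).

Notation point := (point P j).
Notation mean := (@mean R P j).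
Notation same_cell := (@same_cell R P j).
Notation pmean := (@pmean R P p j).

Let e n (t : point) := mart_diff f n.+1 (sval t).
Let a n (t : point) := avg P n (fun y => mart_diff f n.+1 y ^+ 2) (sval t).

Let p20 : 0 < p / 2. Proof. by rewrite divr_gt0. Qed.

Lemma mart_incr_diff : mart_incr same_cell mean e.
Proof.
split=> [n|n u ul]; last by apply: mean_mart => //; case: fM.
exact: (level_sval (mart_diff_cell_inv fM (n := n))).
Qed.

Lemma level_avg n : level same_cell n (a n).
Proof. exact: (level_sval (@avg_cell_inv _ P n _)). Qed.

Lemma a_ge0 n t : 0 <= a n t.
Proof. by apply: avg_ge0 => y; exact: sqr_ge0. Qed.

Lemma mean_a n u : level same_cell n u ->
  mean (fun t => u t * a n t) = mean (fun t => u t * e n t ^+ 2).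
Proof. exact: (mean_avg (leqnSn n) (mart_diff2_cell_inv fM (n := n))). Qed.

Lemma psum_diff n t : psum e n t = f n (sval t).
Proof.
elim: n => [|n IH]; last by rewrite psumS IH /e /= addrC subrK.
by rewrite psum0 (f0_good fM)//; case: (svalP t).
Qed.

Lemma pmean_Fsq N :
  pmean (Fsq f N) = mean (fun t => (runmax (psum e ^~ t) N ^+ 2) `^ (p / 2)).
Proof.
apply: (eq_E mean) => t; congr ((_ ^+ 2) `^ _); apply: eq_runmax => m _.
by rewrite psum_diff.
Qed.

Lemma le_pmean n (X Y : R -> R) : cell_inv n X -> cell_inv n Y ->
  (forall x, 0 <= X x) -> (forall x, good P x -> X x <= Y x) -> pmean X <= pmean Y.
Proof.
move=> Xn Yn X0 XY.
have lev (Z : R -> R) : cell_inv n Z ->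
    level same_cell n (fun t => Z (sval t) `^ (p / 2)).
  by move=> Zn s t st; rewrite (Zn _ _ st).
apply: (@E_le _ _ same_cell mean (@meanD R P j) (@meanZ R P j) (@mean_ge0 R P j) n);
  [exact: lev|exact: lev|].
move=> t; have gt : good P (sval t) by case: (svalP t).
apply: ge0_ler_powR; rewrite ?nnegrE ?(ltW p20)//; last exact: XY.
exact: le_trans (X0 _) (XY _ gt).
Qed.

Let SE := @same_cellS R P j.
Let DE := @meanD R P j.
Let ZE := @meanZ R P j.
Let PE := @mean_ge0 R P j.

Section small_exponent.
Context (p2 : p <= 2).

Let r1 : p / 2 <= 1. Proof. by rewrite ler_pdivrMr// mul1r. Qed.

(** Being predictable and nondecreasing, [ss] serves as its own control. *)
Lemma dominated_ssq : dominated same_cell (psum a) (fun k t => ssq P f k (sval t)).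
Proof.
split=> [k||k x|k x].
- by move=> s t st; apply: eq_bigr => i _; apply: avg_cell_inv;
    apply: cell_le st; rewrite -ltnS.
- by move=> s t st; rewrite /ssq !big_ord0.
- by rewrite /ssq big_ord_recr/= lerDl; exact: a_ge0.
- by rewrite lexx andbT; apply: sumr_ge0 => i _; exact: a_ge0.
Qed.

Lemma pmean_F_s N : pmean (Fsq f N) <= small_cst (p / 2) * pmean (ssq P f N).
Proof.
rewrite pmean_Fsq.
exact: (E_F_small SE DE ZE PE mart_incr_diff p20 r1 N
  (variation_ss SE level_avg mean_a) dominated_ssq).
Qed.

Lemma pmean_S_s N : pmean (Ssq f N) <= small_cst (p / 2) * pmean (ssq P f N).
Proof.
exact: (E_SS_small SE DE ZE PE mart_incr_diff p20 r1 N
  (variation_ss SE level_avg mean_a) dominated_ssq).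
Qed.

Section controlled.
Context (rho : nat -> R -> R) (rhoC : control_sequences rho).

Lemma dominated_rsq (V : nat -> point -> R) :
  (forall k t, 0 <= V k t <= rsq rho k (sval t)) ->
  dominated same_cell V (fun k t => rsq rho k (sval t)).
Proof.
have [_ rnd r0] := rhoC; move=> H; split=> [k s t st||k x|//].
- by rewrite /= (rho_cell_inv rhoC st).
- by [].
- by case: k => [|k] /=; [exact: sqr_ge0|rewrite ler_pXn2r ?nnegrE].
Qed.

Lemma dominated_SS : (forall n x, good P x -> Ssq f n x <= rsq rho n x) ->
  dominated same_cell (psum (fun n t => e n t ^+ 2)) (fun k t => rsq rho k (sval t)).
Proof.
move=> H; apply: dominated_rsq => k t; apply/andP; split; first exact: SS_ge0.
by apply: H; case: (svalP t).
Qed.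

Lemma dominated_f2 : (forall n x, good P x -> f n x ^+ 2 <= rsq rho n x) ->
  dominated same_cell (fun n t => psum e n t ^+ 2) (fun k t => rsq rho k (sval t)).
Proof.
move=> H; apply: dominated_rsq => k t; rewrite sqr_ge0 psum_diff.
by apply: H; case: (svalP t).
Qed.

Lemma pmean_F_Q N : (forall n x, good P x -> Ssq f n x <= rsq rho n x) ->
  pmean (Fsq f N) <= small_cst (p / 2) * pmean (rsq rho N).
Proof.
move=> H; rewrite pmean_Fsq.
exact: (E_F_small SE DE ZE PE mart_incr_diff p20 r1 N (variation_SS SE mart_incr_diff)
  (dominated_SS H)).
Qed.

Lemma pmean_s_Q N : (forall n x, good P x -> Ssq f n x <= rsq rho n x) ->
  pmean (ssq P f N) <= small_cst (p / 2) * pmean (rsq rho N).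
Proof.
move=> H; exact: (E_ss_small SE DE ZE PE mart_incr_diff level_avg a_ge0 mean_a p20 r1 N
  (variation_SS SE mart_incr_diff) (dominated_SS H)).
Qed.

Lemma pmean_S_P N : (forall n x, good P x -> f n x ^+ 2 <= rsq rho n x) ->
  pmean (Ssq f N) <= small_cst (p / 2) * pmean (rsq rho N).
Proof.
move=> H; exact: (E_SS_small SE DE ZE PE mart_incr_diff p20 r1 N
  (variation_f2 SE DE mart_incr_diff) (dominated_f2 H)).
Qed.

Lemma pmean_s_P N : (forall n x, good P x -> f n x ^+ 2 <= rsq rho n x) ->
  pmean (ssq P f N) <= small_cst (p / 2) * pmean (rsq rho N).
Proof.
move=> H; exact: (E_ss_small SE DE ZE PE mart_incr_diff level_avg a_ge0 mean_a p20 r1 N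
  (variation_f2 SE DE mart_incr_diff) (dominated_f2 H)).
Qed.

End controlled.

End small_exponent.

Section large_exponent.
Context (p2 : 2 <= p).

Let r1 : 1 <= p / 2. Proof. by rewrite ler_pdivlMr// mul1r. Qed.

Lemma pmean_s_S N : pmean (ssq P f N) <= (2 * (p / 2)) `^ (p / 2) * pmean (Ssq f N).
Proof. exact: (E_ss_large SE DE ZE PE mart_incr_diff level_avg a_ge0 mean_a r1 N). Qed.

Lemma pmean_S_F N :
  pmean (Ssq f N) <= (2 * (p / 2)) `^ (p / 2) * 5 `^ (p / 2) * pmean (Fsq f N).
Proof. by rewrite pmean_Fsq; exact: (E_SS_large SE DE ZE PE mart_incr_diff r1 N). Qed.

Lemma pmean_F_S N : pmean (Fsq f N) <= burkholder_cst (p / 2) * pmean (Ssq f N).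
Proof. by rewrite pmean_Fsq; exact: (E_F_large SE DE ZE PE mart_incr_diff r1 N). Qed.

End large_exponent.

End unit_inequalities.

(** * Comparison of the norms *)

Section norm_comparison.
Context {R : realType} (P : probability (dyadic_line R) R).

Definition norm_le (A B : (nat -> R -> R) -> \bar R) :=
  exists C : R, 0 < C /\ forall f, martingales0 P f -> (A f <= C%:E * B f)%E.

Lemma norm_le_refl A : norm_le A A.
Proof. by exists 1; split => // f _; rewrite mul1e. Qed.

Lemma norm_le_trans B A D : norm_le A B -> norm_le B D -> norm_le A D.
Proof.
move=> [C [C0 AB]] [C' [C'0 BD]]; exists (C * C'); split; first exact: mulr_gt0.
move=> f fM; apply: le_trans (AB _ fM) _.
by rewrite EFinM -muleA lee_pmul2l// BD.
Qed.

(** Nonnegativity of the right-hand norms allows both constants to be enlarged to their sum. *)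
Lemma norm_le_pair A B A' B' : (forall f, 0 <= B f)%E -> (forall f, 0 <= B' f)%E ->
  norm_le A B -> norm_le A' B' ->
  exists C : R, 0 < C /\ forall f, martingales0 P f ->
    (A f <= C%:E * B f)%E /\ (A' f <= C%:E * B' f)%E.
Proof.
move=> B0 B'0 [C [C0 AB]] [C' [C'0 AB']]; exists (C + C'); split.
  exact: addr_gt0.
move=> f fM; split; [apply: le_trans (AB _ fM) _|apply: le_trans (AB' _ fM) _].
  by rewrite lee_wpmul2r// lee_fin lerDl ltW.
by rewrite lee_wpmul2r// lee_fin lerDr ltW.
Qed.

Context (p : R) (q : \bar R) (p0 : 0 < p) (q0 : (0 < q)%E).

Lemma amalgam_norm_ge0 g : (0 <= amalgam_norm P p q g)%E.
Proof.
case: q q0 => [r _|_|//] /=; first exact: poweR_ge0.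
apply: le_trans (poweR_ge0 (\int[P]_(x in unit_interval 0) (`|g x| `^ p))%E p^-1) _.
by apply: ereal_sup_ubound; exists 0.
Qed.

(** Common form of [Q_norm] and [P_norm]; the infimum over no controls is +oo. *)
Definition control_norm (controls : (nat -> R -> R) -> set (nat -> R -> R)) f : \bar R :=
  ereal_inf [set amalgam_norm P p q (control_limit rho) | rho in controls f].

Lemma control_norm_ge0 controls f : (0 <= control_norm controls f)%E.
Proof.
by apply: le_ereal_inf_tmp => _ [rho _ <-]; exact: amalgam_norm_ge0.
Qed.

Lemma limit_norm_le (X Y : (nat -> R -> R) -> nat -> R -> R)
    (Xi Yi : (nat -> R -> R) -> R -> \bar R) (K : R) : 0 < K ->
  (forall f, martingales0 P f -> square_limit P p (X f) (Xi f)) ->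
  (forall f, martingales0 P f -> square_limit P p (Y f) (Yi f)) ->
  (forall f j N, martingales0 P f -> pmean P p j (X f N) <= K * pmean P p j (Y f N)) ->
  norm_le (fun f => amalgam_norm P p q (Xi f)) (fun f => amalgam_norm P p q (Yi f)).
Proof.
move=> K0 XL YL H; exists (K `^ p^-1); split; first exact: powR_gt0.
move=> f fM; apply: (amalgam_limit_le p0 q0 K0 (XL f fM) (YL f fM)) => j n.
by exists n; exact: H.
Qed.

Lemma limit_norm_le_control (X : (nat -> R -> R) -> nat -> R -> R)
    (Xi : (nat -> R -> R) -> R -> \bar R)
    (controls : (nat -> R -> R) -> set (nat -> R -> R)) (K : R) : 0 < K ->
  (forall f, martingales0 P f -> square_limit P p (X f) (Xi f)) ->
  (forall f rho, controls f rho -> control_sequences rho) ->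
  (forall f rho j N, martingales0 P f -> controls f rho ->
     pmean P p j (X f N) <= K * pmean P p j (rsq rho N)) ->
  norm_le (fun f => amalgam_norm P p q (Xi f)) (control_norm controls).
Proof.
move=> K0 XL cs H; exists (K `^ p^-1); split; first exact: powR_gt0.
move=> f fM; have C0 : 0 < K `^ p^-1 by exact: powR_gt0.
(* After division by the constant the claim is a lower bound for an infimum, checked on each
   control. *)
rewrite -lee_pdivrMl//; apply: le_ereal_inf_tmp => _ [rho frho <-].
rewrite lee_pdivrMl//.
apply: (amalgam_limit_le p0 q0 K0 (XL f fM) (limit_rsq P p0 (cs _ _ frho))) => j n.
by exists n; exact: H.
Qed.

Lemma control_norm_le_limit (Y : (nat -> R -> R) -> nat -> R -> R)
    (Yi : (nat -> R -> R) -> R -> \bar R)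
    (controls : (nat -> R -> R) -> set (nat -> R -> R))
    (rho : (nat -> R -> R) -> nat -> R -> R) (K : R) : 0 < K ->
  (forall f, martingales0 P f -> square_limit P p (Y f) (Yi f)) ->
  (forall f, martingales0 P f -> control_sequences (rho f)) ->
  (forall f, martingales0 P f ->
     (amalgam_norm P p q (control_limit (rho f)) < +oo)%E -> controls f (rho f)) ->
  (forall f j N, martingales0 P f ->
     pmean P p j (rsq (rho f) N) <= K * pmean P p j (Y f N)) ->
  norm_le (control_norm controls) (fun f => amalgam_norm P p q (Yi f)).
Proof.
move=> K0 YL cs mem H; have C0 : 0 < K `^ p^-1 by exact: powR_gt0.
exists (K `^ p^-1); split => // f fM.
(* A control must have finite norm, so [rho f] is one only when the right-hand side is finite;
   otherwise the bound is trivial. *)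
have [->|Yoo] := eqVneq (amalgam_norm P p q (Yi f)) +oo%E.
  by rewrite gt0_muley ?lte_fin// leey.
have le : (amalgam_norm P p q (control_limit (rho f)) <=
           (K `^ p^-1)%:E * amalgam_norm P p q (Yi f))%E.
  apply: (amalgam_limit_le p0 q0 K0 (limit_rsq P p0 (cs f fM)) (YL f fM)) => j n.
  by exists n; exact: H.
apply: (le_trans _ le); apply: ereal_inf_lbound; exists (rho f) => //; apply: mem => //.
apply: (le_lt_trans le); rewrite lte_mul_pinfty ?lee_fin ?(ltW C0)//.
by rewrite lt_neqAle Yoo leey.
Qed.

Section control_bounds.
Context (f : nat -> R -> R) (fM : martingales0 P f) (rho : nat -> R -> R).

Lemma square_fun_uptoE n x : square_fun_upto f n.+1 x = Num.sqrt (Ssq f n.+1 x).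
Proof.
rewrite /square_fun_upto big_ord_recl /= normr0 expr0n add0r; congr Num.sqrt.
by apply: eq_bigr => i _; rewrite real_normK ?num_real.
Qed.

Lemma Ssq_ge0 n x : 0 <= Ssq f n x.
Proof. by apply: sumr_ge0 => i _; exact: sqr_ge0. Qed.

Lemma Ssq_cell_inv n : cell_inv n (Ssq f n).
Proof. exact: square_limit_inv (limit_Ssq p0 fM) n. Qed.

Lemma Fsq_cell_inv n : cell_inv n (Fsq f n).
Proof. exact: square_limit_inv (limit_Fsq p0 fM) n. Qed.

Lemma Q_controls_le n x : Q_controls P p q f rho -> good P x ->
  Ssq f n x <= rsq rho n x.
Proof.
move=> [rhoC H _] gx; case: n => [|n]; first by rewrite /Ssq big_ord0.
have : square_fun_upto f n.+1 x <= rho n x.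
  move: x gx; apply: (ae_good (n := n.+1) _ (H n)) => x y xy.
  by rewrite !square_fun_uptoE (Ssq_cell_inv xy) (rho_cell_inv rhoC (cellS xy)).
have [_ _ r0] := rhoC.
rewrite square_fun_uptoE -(ler_pXn2r (n := 2)) ?nnegrE ?sqrtr_ge0//.
by rewrite sqr_sqrtr// Ssq_ge0.
Qed.

Lemma Q_controlsI : control_sequences rho ->
  (forall n x, good P x -> Ssq f n.+1 x <= rho n x ^+ 2) ->
  (amalgam_norm P p q (control_limit rho) < +oo)%E -> Q_controls P p q f rho.
Proof.
move=> rhoC H fin; split=> // n; apply: good_ae => x gx; have [_ _ r0] := rhoC.
rewrite square_fun_uptoE -(ler_pXn2r (n := 2)) ?nnegrE ?sqrtr_ge0//.
by rewrite sqr_sqrtr ?Ssq_ge0// H.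
Qed.

Lemma P_controls_le n x : P_controls P p q f rho -> good P x ->
  f n x ^+ 2 <= rsq rho n x.
Proof.
move=> [rhoC H _] gx; case: n => [|n]; first by rewrite (f0_good fM)// expr0n.
have : `|f n.+1 x| <= rho n x.
  move: x gx; apply: (ae_good (n := n.+1) _ (H n)) => x y xy.
  by rewrite (f_cell_inv fM xy) (rho_cell_inv rhoC (cellS xy)).
have [_ _ r0] := rhoC.
by rewrite -(ler_pXn2r (n := 2)) ?nnegrE// real_normK ?num_real.
Qed.

(** The running maximum is attained at some m <= n, and the control is monotone. *)
Lemma P_controls_Fsq n x : P_controls P p q f rho -> good P x ->
  Fsq f n x <= rsq rho n x.
Proof.
move=> fr gx; have [rhoC _ _] := fr; have [_ rnd r0] := rhoC.
have [m mn E] := runmax_attained (fun k => f k x) n.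
rewrite /Fsq E real_normK ?num_real//; apply: le_trans (P_controls_le m fr gx) _.
apply: (@homo_leq _ (rsq rho ^~ x) <=%O (fun=> lexx _) le_trans) => // k.
by case: k => [|k] /=; [exact: sqr_ge0|rewrite ler_pXn2r ?nnegrE].
Qed.

Lemma P_controlsI : control_sequences rho ->
  (forall n x, good P x -> Fsq f n.+1 x <= rho n x ^+ 2) ->
  (amalgam_norm P p q (control_limit rho) < +oo)%E -> P_controls P p q f rho.
Proof.
move=> rhoC H fin; split=> // n; apply: good_ae => x gx; have [_ _ r0] := rhoC.
rewrite -(ler_pXn2r (n := 2)) ?nnegrE//; apply: le_trans (H n x gx).
rewrite ler_pXn2r ?nnegrE ?runmax_ge0//; exact: (le_runmax (fun k => f k x)).
Qed.

End control_bounds.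

Lemma star_le_P : norm_le (Hstar_norm P p q) (P_norm P p q).
Proof.
apply: (limit_norm_le_control (K := 1) (X := Fsq)) => //.
- by move=> f fM; exact: limit_Fsq.
- by move=> f rho [].
move=> f rho j N fM frho; rewrite mul1r; have [rhoC _ _] := frho.
apply: (@le_pmean R P p p0 j N).
- exact: (@Fsq_cell_inv f fM N).
- exact: square_limit_inv (limit_rsq P p0 rhoC) N.
- by move=> x; exact: sqr_ge0.
- by move=> x; exact: P_controls_Fsq.
Qed.

Lemma S_le_Q : norm_le (HS_norm P p q) (Q_norm P p q).
Proof.
apply: (limit_norm_le_control (K := 1) (X := Ssq)) => //.
- by move=> f fM; exact: limit_Ssq.
- by move=> f rho [].
move=> f rho j N fM frho; rewrite mul1r; have [rhoC _ _] := frho.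
apply: (@le_pmean R P p p0 j N).
- exact: (@Ssq_cell_inv f fM N).
- exact: square_limit_inv (limit_rsq P p0 rhoC) N.
- by move=> x; exact: Ssq_ge0.
- by move=> x; exact: Q_controls_le.
Qed.

Section small.
Context (p2 : p <= 2).

Let K0 : 0 < small_cst (p / 2). Proof. by apply: small_cst_gt0; rewrite divr_gt0. Qed.

Lemma star_le_s_small : norm_le (Hstar_norm P p q) (Hs_norm P p q).
Proof.
apply: (limit_norm_le (X := Fsq) (Y := ssq P) K0) => [f fM|f fM|f j N fM].
- exact: limit_Fsq.
- exact: limit_ssq.
- exact: pmean_F_s.
Qed.

Lemma S_le_s_small : norm_le (HS_norm P p q) (Hs_norm P p q).
Proof.
apply: (limit_norm_le (X := Ssq) (Y := ssq P) K0) => [f fM|f fM|f j N fM].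
- exact: limit_Ssq.
- exact: limit_ssq.
- exact: pmean_S_s.
Qed.

Lemma star_le_Q_small : norm_le (Hstar_norm P p q) (Q_norm P p q).
Proof.
apply: (limit_norm_le_control (X := Fsq) K0) => [f fM|f rho []//|f rho j N fM fr].
- exact: limit_Fsq.
- have [rhoC _ _] := fr.
  by apply: pmean_F_Q => // n x; exact: Q_controls_le.
Qed.

Lemma s_le_Q_small : norm_le (Hs_norm P p q) (Q_norm P p q).
Proof.
apply: (limit_norm_le_control (X := ssq P) K0) => [f fM|f rho []//|f rho j N fM fr].
- exact: limit_ssq.
- have [rhoC _ _] := fr.
  by apply: pmean_s_Q => // n x; exact: Q_controls_le.
Qed.

Lemma S_le_P_small : norm_le (HS_norm P p q) (P_norm P p q).
Proof.
apply: (limit_norm_le_control (X := Ssq) K0) => [f fM|f rho []//|f rho j N fM fr].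
- exact: limit_Ssq.
- have [rhoC _ _] := fr.
  by apply: pmean_S_P => // n x; exact: P_controls_le.
Qed.

Lemma s_le_P_small : norm_le (Hs_norm P p q) (P_norm P p q).
Proof.
apply: (limit_norm_le_control (X := ssq P) K0) => [f fM|f rho []//|f rho j N fM fr].
- exact: limit_ssq.
- have [rhoC _ _] := fr.
  by apply: pmean_s_P => // n x; exact: P_controls_le.
Qed.

End small.

Section large.
Context (p2 : 2 <= p).

Lemma s_le_S_large : norm_le (Hs_norm P p q) (HS_norm P p q).
Proof.
apply: (limit_norm_le (X := ssq P) (Y := Ssq) (K := (2 * (p / 2)) `^ (p / 2)))
  => [|f fM|f fM|f j N fM].
- by rewrite powR_gt0 ?mulr_gt0 ?divr_gt0.
- exact: limit_ssq.
- exact: limit_Ssq.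
- exact: pmean_s_S.
Qed.

Lemma S_le_star_large : norm_le (HS_norm P p q) (Hstar_norm P p q).
Proof.
apply: (limit_norm_le (X := Ssq) (Y := Fsq)
  (K := (2 * (p / 2)) `^ (p / 2) * 5 `^ (p / 2))) => [|f fM|f fM|f j N fM].
- by rewrite mulr_gt0 ?powR_gt0 ?mulr_gt0 ?divr_gt0.
- exact: limit_Ssq.
- exact: limit_Fsq.
- exact: pmean_S_F.
Qed.

Lemma star_le_S_large : norm_le (Hstar_norm P p q) (HS_norm P p q).
Proof.
apply: (limit_norm_le (X := Fsq) (Y := Ssq) (K := burkholder_cst (p / 2)))
  => [|f fM|f fM|f j N fM].
- by rewrite /burkholder_cst !mulr_gt0 ?powR_gt0 ?mulr_gt0 ?divr_gt0.
- exact: limit_Fsq.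
- exact: limit_Ssq.
- exact: pmean_F_S.
Qed.

Lemma s_le_star_large : norm_le (Hs_norm P p q) (Hstar_norm P p q).
Proof. exact: norm_le_trans s_le_S_large S_le_star_large. Qed.

End large.

(** For p >= 2 the route is through S(f), which the control dominates pathwise; the next three
    lemmas use the same split at 2. *)
Lemma star_le_Q : norm_le (Hstar_norm P p q) (Q_norm P p q).
Proof.
have [p2|/ltW p2] := leP p 2; first exact: star_le_Q_small.
exact: norm_le_trans (star_le_S_large p2) S_le_Q.
Qed.

Lemma S_le_P : norm_le (HS_norm P p q) (P_norm P p q).
Proof.
have [p2|/ltW p2] := leP p 2; first exact: S_le_P_small.
exact: norm_le_trans (S_le_star_large p2) star_le_P.
Qed.

Lemma s_le_P : norm_le (Hs_norm P p q) (P_norm P p q).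
Proof.
have [p2|/ltW p2] := leP p 2; first exact: s_le_P_small.
exact: norm_le_trans (s_le_star_large p2) star_le_P.
Qed.

Lemma s_le_Q : norm_le (Hs_norm P p q) (Q_norm P p q).
Proof.
have [p2|/ltW p2] := leP p 2; first exact: s_le_Q_small.
exact: norm_le_trans (s_le_S_large p2) S_le_Q.
Qed.

End norm_comparison.

(** * Regular filtrations *)

Section regular.
Context {R : realType} (P : probability (dyadic_line R) R).

Notation mline := (@measurable _ (dyadic_line R)).

(* P(I | F_m) / P(I), where I is the cell of level [n.+1] of the good point [x0]. *)
Section test_martingale.
Context (n : nat) (x0 : R) (gx0 : good P x0).

(** The martingale is stopped at level [n.+1]; the factor [w] gives it integral 1 at every time. *)
Let lev m := minn m n.+1.
Let J m : set R := cell_set (lev m) (cell (lev m) x0).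
Let w m : R := (fine (P (J m)))^-1.

Definition cell_mart m (x : R) : R := w m * \1_(J m) x.

Let pJ m : fine (P (J m)) != 0.
Proof.
rewrite fine_eq0; first exact: gx0.
by apply: fin_num_measure; exact: measurable_cell_set.
Qed.

Let pJ_gt0 m : 0 < fine (P (J m)).
Proof. by rewrite lt_def pJ fine_ge0// measure_ge0. Qed.

Let w_ge0 m : 0 <= w m. Proof. by rewrite invr_ge0 ltW. Qed.

Let mJ m : mline (J m). Proof. exact: measurable_cell_set. Qed.

Lemma cell_mart_inv m : cell_inv m (cell_mart m).
Proof.
apply: (@cell_invS _ _ (lev m)); first exact: geq_minl.
move=> x y xy; rewrite /cell_mart !indicE.
suff -> : (x \in J m) = (y \in J m) by [].
by apply: asbool_equiv_eq; rewrite /J /cell_set/= xy.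
Qed.

(** The cell [J m] lies inside [A] or misses it, according to the position of [x0]. The value does
    not depend on [m], which is the martingale property. *)
Lemma cell_mart_integral m (A : set R) : mline A -> cell_inv (lev m) A ->
  (\int[P]_(x in A) (cell_mart m x)%:E = if x0 \in A then 1 else 0)%E.
Proof.
move=> mA An; rewrite /cell_mart.
have -> : (\int[P]_(x in A) (w m * \1_(J m) x)%:E =
          (w m)%:E * \int[P]_(x in A) (\1_(J m) x)%:E)%E.
  rewrite -ge0_integralZl_EFin//.
  by apply/measurable_EFinP; exact: measurable_indic.
have -> : (\int[P]_(x in A) (\1_(J m) x)%:E = P (J m `&` A))%E.
  exact: integral_indic.
case: ifPn => [|/negP] x0A.
  rewrite (_ : J m `&` A = J m); last first.
    apply/seteqP; split=> [x []//|x Jx]; split=> //.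
    by rewrite (An x x0)//; exact: set_mem x0A.
  have pf : P (J m) \is a fin_num by apply: fin_num_measure; exact: mJ.
  by rewrite -[X in (_ * X)%E](fineK pf) -EFinM mulVf.
rewrite (_ : J m `&` A = set0) ?measure0 ?mule0//.
rewrite -subset0 => x [Jx Ax]; apply: x0A; apply: mem_set.
by rewrite -(An x x0).
Qed.

Lemma cell_mart_is_martingale : is_martingale P cell_mart.
Proof.
split=> [m|m|m]; first exact: cell_inv_measurable (@cell_mart_inv m).
  apply: measurable_bounded_integrable => //.
  - by rewrite (le_lt_trans (probability_le1 _ measurableT))// ltry.
  - exact: (cell_inv_measurable_line measurableT (@cell_mart_inv m)).
  - exists (w m); split; first exact: num_real.
    move=> M wM x _ /=; rewrite ger0_norm ?mulr_ge0//.
    by apply: le_trans (ltW wM); rewrite ler_piMr// indicE.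
split; first by apply: cell_inv_measurable => x y /cell_mart_inv xy; rewrite /= xy.
move=> A nA; have mA := dyadic_sigma_measurable nA.
have [mn|nm] := ltnP m n.+1; last first.
  have E : lev m.+1 = lev m by rewrite /lev !(minn_idPr _)// leqW.
  by rewrite /cell_mart /w /J E.
have /dyadic_sigmaP An := nA.
have lm : lev m = m by rewrite /lev (minn_idPl _)// ltnW.
have lm1 : lev m.+1 = m.+1 by rewrite /lev (minn_idPl _).
rewrite [LHS]cell_mart_integral ?lm// [RHS]cell_mart_integral ?lm1//.
exact: cell_invS An.
Qed.

Lemma cell_mart_self m : cell_mart m x0 = w m.
Proof. by rewrite /cell_mart indicE mem_set// mulr1. Qed.

(** Regularity of the test martingale, read at [x0], compares the inverse masses of a cell and of
    its parent. *)
Lemma regular_prob (K : R) : (forall f, is_martingale P f ->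
    (forall n, {ae P, forall x, 0 <= f n x}) ->
    forall n, {ae P, forall x, f n.+1 x <= K * f n x}) ->
  fine (P (cell_set n (cell n x0))) <= K * fine (P (cell_set n.+1 (cell n.+1 x0))).
Proof.
move=> /(_ _ cell_mart_is_martingale) H.
have H1 : cell_mart n.+1 x0 <= K * cell_mart n x0.
  apply: (@ae_good _ P (fun x => cell_mart n.+1 x <= K * cell_mart n x) n.+1) => //.
    by move=> x y xy; rewrite (cell_mart_inv xy) (cell_mart_inv (cellS xy)).
  by apply: H => m; apply: good_ae => x _; rewrite mulr_ge0.
have lev_n : lev n = n by rewrite /lev (minn_idPl _).
have lev_n1 : lev n.+1 = n.+1 by rewrite /lev minnn.
move: H1 (pJ_gt0 n) (pJ_gt0 n.+1); rewrite !cell_mart_self /w /J lev_n lev_n1.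
set b := fine _; set b' := fine _ => H1 b0 b'0.
by move: H1; rewrite ler_pdivlMr// mulrC ler_pdivrMr.
Qed.

End test_martingale.

(** With B the cell of [x] at level [n.+1] and A its parent: h(x) P(B) is the integral over B, at
    most the integral over A, which is avg P(A) <= K avg P(B). *)
Lemma regular_avg : regular_filtration P -> exists2 K : R, 0 < K &
  forall n (h : R -> R) x, (forall y, 0 <= h y) -> cell_inv n.+1 h -> good P x ->
    h x <= K * avg P n h x.
Proof.
move=> [K [K0 reg]]; exists K => // n h x h0 hn gx.
have pK := @regular_prob n x gx K reg.
set A := cell_set n (cell n x) in pK; set B := cell_set n.+1 (cell n.+1 x) in pK.
have mA : mline A by exact: measurable_cell_set.
have mB : mline B by exact: measurable_cell_set.
have BA : B `<=` A by move=> y /cellS.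
have iA : P.-integrable A (EFin \o h) by exact: cell_integrable hn.
have iB : P.-integrable B (EFin \o h) by exact: cell_integrable hn.
have sub : \int[P]_(y in B) h y <= \int[P]_(y in A) h y.
  apply: fine_le.
  - exact: integrable_fin_num iB.
  - exact: integrable_fin_num iA.
  apply: ge0_subset_integral => //; last by move=> y _; rewrite lee_fin.
  exact: measurable_int iA.
have hB : \int[P]_(y in B) h y = h x * fine (P B).
  rewrite -Rintegral_cst//; apply: eq_Rintegral => y; rewrite inE => yB.
  exact: hn.
have PA : fine (P A) != 0.
  by rewrite fine_eq0; [exact: gx|exact: fin_num_measure].
have PB : fine (P B) != 0.
  by rewrite fine_eq0; [exact: gx|exact: fin_num_measure].
have PB0 : 0 < fine (P B) by rewrite lt_def PB fine_ge0// measure_ge0.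
have PA0 : 0 < fine (P A) by rewrite lt_def PA fine_ge0// measure_ge0.
rewrite -(ler_pM2r PB0) -hB; apply: (le_trans sub).
rewrite -[leLHS](divfK PA) -/(avg P n h x) [leRHS]mulrAC [leLHS]mulrC.
by apply: ler_wpM2r pK; exact: avg_ge0.
Qed.

Section predictable_control.
Context (K : R) (K0 : 0 < K).
Context (regK : forall n (h : R -> R) x, (forall y, 0 <= h y) -> cell_inv n.+1 h ->
  good P x -> h x <= K * avg P n h x).
Context (p : R) (p0 : 0 < p).

Let p20 : 0 < p / 2. Proof. by rewrite divr_gt0. Qed.

(* [K] times the compensator of [Y n `^ (p / 2)]; regularity makes it dominate that
   process, while its mean is only [K] times larger. *)
Definition compensator (Y : nat -> R -> R) n (x : R) : R :=
  K * \sum_(i < n.+1) avg P i (fun y => Y i.+1 y `^ (p / 2) - Y i y `^ (p / 2)) x.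

(** The root 1/p is taken so that the square of the control, raised to p/2, returns the
    compensator. *)
Definition compensator_control (Y : nat -> R -> R) n x : R := compensator Y n x `^ p^-1.

Context (Y : nat -> R -> R) (Y0 : forall n x, 0 <= Y n x)
  (Yn : forall n, cell_inv n (Y n)) (Yd : forall n x, Y n x <= Y n.+1 x)
  (Yz : forall x, good P x -> Y 0%N x = 0).

Let X n x := Y n x `^ (p / 2).
Let dX n x := X n.+1 x - X n x.

Let dX_ge0 n x : 0 <= dX n x.
Proof. by rewrite subr_ge0; apply: ge0_ler_powR; rewrite ?nnegrE// ltW. Qed.

Let X_inv n : cell_inv n (X n).
Proof. by move=> x y xy; rewrite /X (Yn xy). Qed.

Let dX_inv n : cell_inv n.+1 (dX n).
Proof. by move=> x y xy; rewrite /dX (X_inv xy) (X_inv (cellS xy)). Qed.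

Lemma compensator_ge0 n x : 0 <= compensator Y n x.
Proof.
apply: mulr_ge0; first exact: ltW.
by apply: sumr_ge0 => i _; apply: avg_ge0 => y; exact: dX_ge0.
Qed.

Lemma compensator_cell_inv n : cell_inv n (compensator Y n).
Proof.
move=> x y xy; congr (_ * _); apply: eq_bigr => i _; apply: avg_cell_inv.
by apply: cell_le xy; rewrite -ltnS.
Qed.

Lemma compensator_control_seq : control_sequences (compensator_control Y).
Proof.
split=> [n|n x|n x]; last exact: powR_ge0.
  apply: cell_inv_measurable => x y xy.
  by rewrite /compensator_control (compensator_cell_inv xy).
apply: ge0_ler_powR; rewrite ?nnegrE ?invr_ge0 ?(ltW p0) ?compensator_ge0//.
rewrite /compensator ler_pM2l// [leRHS]big_ord_recr/= lerDl.
by apply: avg_ge0 => y; exact: dX_ge0.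
Qed.

Let sumX n x : X n x = X 0%N x + \sum_(i < n) dX i x.
Proof.
elim: n => [|n IH]; first by rewrite big_ord0 addr0.
by rewrite big_ord_recr/= addrA -IH addrC subrK.
Qed.

(** Y_(n+1)^(p/2) telescopes from 0, and regularity bounds each increment by K times its average one
    level below. *)
Lemma compensator_ge n x : good P x -> Y n.+1 x <= compensator_control Y n x ^+ 2.
Proof.
move=> gx.
have -> : Y n.+1 x = (X n.+1 x `^ p^-1) ^+ 2.
  rewrite -powR_mulrn ?powR_ge0// -!powRrM.
  by rewrite (_ : _ * _ = 1) ?powRr1//; field; rewrite gt_eqF.
rewrite ler_pXn2r ?nnegrE ?powR_ge0//; apply: ge0_ler_powR;
  rewrite ?nnegrE ?invr_ge0 ?(ltW p0) ?powR_ge0 ?compensator_ge0//.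
rewrite sumX /X (Yz gx) powR0 ?gt_eqF// add0r /compensator mulr_sumr.
by apply: ler_sum => i _; apply: regK.
Qed.

(** Averaging preserves means, so the means of the compensating terms telescope again. *)
Lemma pmean_compensator j N :
  pmean P p j (rsq (compensator_control Y) N) <= K * pmean P p j (Y N).
Proof.
case: N => [|n].
  apply: (@le_trans _ _ 0).
    rewrite /pmean (eq_E _ (g := fun=> 0)); last first.
      by move=> t; rewrite /= powR0 ?gt_eqF.
    by rewrite (E0 (@meanZ R P j)).
  by apply: mulr_ge0; [exact: ltW|apply: mean_ge0 => t; exact: powR_ge0].
have DE := @meanD R P j; have ZE := @meanZ R P j.
have lev m (Z : R -> R) : cell_inv m Z ->
  level (@same_cell R P j) m (fun t => Z (sval t)) by exact: level_sval.
have avn (i : 'I_n.+1) : cell_inv n.+1 (avg P i (dX i)).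
  by apply: (cell_invS _ (@avg_cell_inv _ P i _)); exact: ltnW.
have dXn (i : 'I_n.+1) : cell_inv n.+1 (dX i) by exact: cell_invS (@dX_inv i).
have -> : pmean P p j (rsq (compensator_control Y) n.+1) =
    mean (fun t : point P j => compensator Y n (sval t)).
  apply: (eq_E (@mean R P j)) => t; rewrite /= sqr_powR_half ?powR_ge0//.
  by rewrite -powRrM mulVf ?gt_eqF// powRr1// compensator_ge0.
rewrite /compensator (ZE n.+1); last first.
  by move=> s t st; apply: eq_bigr => i _; apply: avn.
rewrite ler_pM2l// (E_sum DE ZE (n := n.+1)
  (h := fun i t => avg P i (dX i) (sval t))); last first.
  by move=> i iN; exact: lev (avn (Ordinal iN)).
have -> : \sum_(i < n.+1) mean (fun t : point P j => avg P i (dX i) (sval t)) =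
          \sum_(i < n.+1) mean (fun t : point P j => dX i (sval t)).
  apply: eq_bigr => i _.
  have l1 : level (@same_cell R P j) i (fun=> 1 : R) by [].
  have m1 (g : point P j -> R) : mean (fun t => 1 * g t) = mean g.
    by apply: (eq_E (@mean R P j)) => t; rewrite mul1r.
  by have := mean_avg (leqnSn i) (@dX_inv i) l1; rewrite !m1.
rewrite -(E_sum DE ZE (n := n.+1) (h := fun i t => dX i (sval t))); last first.
  by move=> i iN; exact: lev (dXn (Ordinal iN)).
apply: (E_le DE ZE (@mean_ge0 R P j) (n := n.+1)).
- by move=> s t st; apply: eq_bigr => i _; apply: dXn.
- exact: lev (@X_inv n.+1).
- by move=> t; rewrite -/(X n.+1 (sval t)) sumX lerDr powR_ge0.
Qed.

End predictable_control.
End regular.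

Section regular_norms.
Context {R : realType} (P : probability (dyadic_line R) R) (p : R) (q : \bar R).
Context (p0 : 0 < p) (q0 : (0 < q)%E) (reg : regular_filtration P).

Lemma P_le_star : norm_le P (P_norm P p q) (Hstar_norm P p q).
Proof.
have [K K0 regK] := regular_avg reg.
have Fd (f : nat -> R -> R) n x : Fsq f n x <= Fsq f n.+1 x.
  by rewrite ler_pXn2r ?nnegrE ?runmax_ge0// runmaxS.
have F0 (f : nat -> R -> R) n x : 0 <= Fsq f n x by exact: sqr_ge0.
have Fn f (fM : martingales0 P f) n : cell_inv n (Fsq f n).
  exact: (@Fsq_cell_inv _ P p p0 f fM n).
have Fz f (fM : martingales0 P f) x : good P x -> Fsq f 0 x = 0.
  by move=> gx; rewrite /Fsq /= (f0_good fM gx) normr0 expr0n.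
apply: (control_norm_le_limit p0 q0 (Y := Fsq)
  (rho := fun f => compensator_control P K p (Fsq f)) K0) => [f fM|f fM|f fM|f j N fM].
- exact: limit_Fsq.
- exact: (compensator_control_seq P K0 p0 (F0 f) (Fd f)).
- apply: P_controlsI; first exact: (compensator_control_seq P K0 p0 (F0 f) (Fd f)).
  by move=> n x gx; exact: (compensator_ge K0 regK p0 (F0 f) (Fn f fM) (Fd f) (Fz f fM) n gx).
- exact: (pmean_compensator P K0 p0 (F0 f) (Fn f fM) (Fd f)).
Qed.

Lemma Q_le_S : norm_le P (Q_norm P p q) (HS_norm P p q).
Proof.
have [K K0 regK] := regular_avg reg.
have Sd (f : nat -> R -> R) n x : Ssq f n x <= Ssq f n.+1 x.
  by rewrite /Ssq big_ord_recr/= lerDl sqr_ge0.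
have S0 (f : nat -> R -> R) n x : 0 <= Ssq f n x by exact: Ssq_ge0.
have Sn f (fM : martingales0 P f) n : cell_inv n (Ssq f n).
  exact: (@Ssq_cell_inv _ P p p0 f fM n).
have Sz (f : nat -> R -> R) x : good P x -> Ssq f 0 x = 0.
  by rewrite /Ssq big_ord0.
apply: (control_norm_le_limit p0 q0 (Y := Ssq)
  (rho := fun f => compensator_control P K p (Ssq f)) K0) => [f fM|f fM|f fM|f j N fM].
- exact: limit_Ssq.
- exact: (compensator_control_seq P K0 p0 (S0 f) (Sd f)).
- apply: Q_controlsI => //.
    exact: (compensator_control_seq P K0 p0 (S0 f) (Sd f)).
  by move=> n x gx; exact: (compensator_ge K0 regK p0 (S0 f) (Sn f fM) (Sd f) (Sz f) n gx).
- exact: (pmean_compensator P K0 p0 (S0 f) (Sn f fM) (Sd f)).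
Qed.

(** s_(n+1)^2 is of level [n] and, by regularity term by term, K s_(n+1)^2 dominates S_(n+1)^2; so
    its root is a control. *)
Lemma Q_le_s : norm_le P (Q_norm P p q) (Hs_norm P p q).
Proof.
have [K K0 regK] := regular_avg reg.
pose rho (f : nat -> R -> R) n x := Num.sqrt (K * ssq P f n.+1 x).
have a0 (f : nat -> R -> R) i x : 0 <= avg P i (fun y => mart_diff f i.+1 y ^+ 2) x.
  by apply: avg_ge0 => y; exact: sqr_ge0.
have s0 f n x : 0 <= ssq P f n x by apply: sumr_ge0 => i _.
have Ks0 f n x : 0 <= K * ssq P f n x by rewrite mulr_ge0// ltW.
have rhoC f : control_sequences (rho f).
  split=> [n|n x|n x]; last exact: sqrtr_ge0.
    apply: cell_inv_measurable => x y xy; congr (Num.sqrt (_ * _)).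
    apply: eq_bigr => i _; apply: avg_cell_inv.
    by apply: cell_le xy; rewrite -ltnS.
  apply: ler_wsqrtr; rewrite ler_pM2l// /ssq [leRHS]big_ord_recr/= lerDl.
  exact: a0.
apply: (control_norm_le_limit p0 q0 (Y := ssq P) (rho := rho) (K := K `^ (p / 2)))
  => [|f fM|//|f fM|f j N fM].
- exact: powR_gt0.
- exact: limit_ssq.
- apply: Q_controlsI => // n x gx; rewrite sqr_sqrtr//.
  rewrite mulr_sumr; apply: ler_sum => i _.
  apply: (regK i (fun y => mart_diff f i.+1 y ^+ 2) x _ _ gx).
    by move=> y; exact: sqr_ge0.
  exact: (mart_diff2_cell_inv fM (n := i)).
have sl : level (@same_cell R P j) N (fun t => ssq P f N (sval t) `^ (p / 2)).
  move=> s t st; congr (_ `^ _); apply: eq_bigr => i _; apply: avg_cell_inv.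
  by apply: cell_le st; exact: ltnW.
suff -> : pmean P p j (rsq (rho f) N) = K `^ (p / 2) * pmean P p j (ssq P f N) by [].
have Z := @meanZ R P j N (K `^ (p / 2)) _ sl; apply: (etrans _ Z).
apply: (eq_E (@mean R P j)) => t; rewrite -powRM ?(ltW K0)//; congr (_ `^ _).
case: (N) => [|m]; first by rewrite /ssq big_ord0 mulr0.
by rewrite /= sqr_sqrtr.
Qed.

Lemma norm_le_Q X : norm_le P (hardy_norm P p q X) (Q_norm P p q).
Proof.
case: X => /=; [exact: S_le_Q|exact: s_le_Q|exact: star_le_Q|exact: norm_le_refl|].
by apply: (norm_le_trans P_le_star); exact: star_le_Q.
Qed.

(** [Q_norm] is the hub: Q <= S <= P <= star gives every bound except Q <= s, which is [Q_le_s]. *)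
Lemma Q_norm_le X : norm_le P (Q_norm P p q) (hardy_norm P p q X).
Proof.
have QP : norm_le P (Q_norm P p q) (P_norm P p q).
  by apply: (norm_le_trans Q_le_S); exact: S_le_P.
case: X => /=; [exact: Q_le_S|exact: Q_le_s| |exact: norm_le_refl|exact: QP].
exact: (norm_le_trans QP P_le_star).
Qed.

End regular_norms.

(** * The five spaces as sets of finite norm *)

Section hardy_spaces.
Context {R : realType} (P : probability (dyadic_line R) R) (p : R) (q : \bar R).

(** The spaces for Q and P are defined by existence of a control; as every control has finite norm,
    this is finiteness of the infimum, and all five spaces can be treated alike. *)
Lemma control_norm_fin (S : set (nat -> R -> R)) :
  (forall rho, S rho -> amalgam_norm P p q (control_limit rho) < +oo)%E ->
  S !=set0 <->
  (ereal_inf [set amalgam_norm P p q (control_limit rho) | rho in S] < +oo)%E.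
Proof.
move=> fin; split=> [[rho Srho]|].
  apply: le_lt_trans (fin _ Srho).
  by apply: ereal_inf_lbound; exists rho.
by move=> /ereal_inf_lt [_ [rho Srho _] _]; exists rho.
Qed.

Lemma hardy_spaceE X :
  hardy_space P p q X = [set f | martingales0 P f /\ (hardy_norm P p q X f < +oo)%E].
Proof.
have QE f := @control_norm_fin (Q_controls P p q f).
have PE f := @control_norm_fin (P_controls P p q f).
case: X => //=; apply/seteqP; split=> f [fM H]; split => //.
- by apply/(iffLR (QE f _)) => // rho [].
- by apply: (iffRL (QE f _) H) => rho [].
- by apply/(iffLR (PE f _)) => // rho [].
- by apply: (iffRL (PE f _) H) => rho [].
Qed.

End hardy_spaces.

Unset Implicit Arguments.

Theorem theorem3p1 (R : realType) (P : probability (dyadic_line R) R)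
    (q : \bar R) (hq : (0 < q)%E) :
  [/\ (forall p : R, 0 < p -> p <= 2 ->
        exists C : R, 0 < C /\ forall f, martingales0 P f ->
          (Hstar_norm P p q f <= C%:E * Hs_norm P p q f)%E /\
          (HS_norm P p q f <= C%:E * Hs_norm P p q f)%E),
      (forall p : R, 2 <= p ->
        exists C : R, 0 < C /\ forall f, martingales0 P f ->
          (Hs_norm P p q f <= C%:E * Hstar_norm P p q f)%E /\
          (Hs_norm P p q f <= C%:E * HS_norm P p q f)%E),
      (forall p : R, 0 < p ->
        exists C : R, 0 < C /\ forall f, martingales0 P f ->
          (Hstar_norm P p q f <= C%:E * P_norm P p q f)%E /\
          (HS_norm P p q f <= C%:E * Q_norm P p q f)%E),
      (forall p : R, 0 < p ->
        exists C : R, 0 < C /\ forall f, martingales0 P f ->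
          (Hstar_norm P p q f <= C%:E * Q_norm P p q f)%E /\
          (HS_norm P p q f <= C%:E * P_norm P p q f)%E) &
      (forall p : R, 0 < p ->
        exists C : R, 0 < C /\ forall f, martingales0 P f ->
          (Hs_norm P p q f <= C%:E * P_norm P p q f)%E /\
          (Hs_norm P p q f <= C%:E * Q_norm P p q f)%E)] /\
  (regular_filtration P ->
   forall p : R, 0 < p -> forall X Y : hardy,
     hardy_space P p q X = hardy_space P p q Y /\
     exists c C : R, [/\ 0 < c, 0 < C &
       forall f, hardy_space P p q X f ->
         (c%:E * hardy_norm P p q X f <= hardy_norm P p q Y f)%E /\
         (hardy_norm P p q Y f <= C%:E * hardy_norm P p q X f)%E]).
Proof.
have H2 : (0 : R) < 2 by [].
split; first split.
- move=> p p0 p2; apply: norm_le_pair.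
  + by move=> f; exact: amalgam_norm_ge0.
  + by move=> f; exact: amalgam_norm_ge0.
  + exact: star_le_s_small.
  + exact: S_le_s_small.
- move=> p p2; have p0 := lt_le_trans H2 p2; apply: norm_le_pair.
  + by move=> f; exact: amalgam_norm_ge0.
  + by move=> f; exact: amalgam_norm_ge0.
  + exact: s_le_star_large.
  + exact: s_le_S_large.
- move=> p p0; apply: norm_le_pair.
  + by move=> f; exact: control_norm_ge0.
  + by move=> f; exact: control_norm_ge0.
  + exact: star_le_P.
  + exact: S_le_Q.
- move=> p p0; apply: norm_le_pair.
  + by move=> f; exact: control_norm_ge0.
  + by move=> f; exact: control_norm_ge0.
  + exact: star_le_Q.
  + exact: S_le_P.
- move=> p p0; apply: norm_le_pair.
  + by move=> f; exact: control_norm_ge0.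
  + by move=> f; exact: control_norm_ge0.
  + exact: s_le_P.
  + exact: s_le_Q.
move=> reg p p0 X Y.
have le A B : norm_le P (hardy_norm P p q A) (hardy_norm P p q B).
  exact: (norm_le_trans (norm_le_Q p0 hq reg A) (Q_norm_le p0 hq reg B)).
have sub A B f : hardy_space P p q A f -> hardy_space P p q B f.
  rewrite !hardy_spaceE => -[fM Af]; split=> //; have [C [C0 BA]] := le B A.
  apply: le_lt_trans (BA f fM) _; rewrite lte_mul_pinfty ?lee_fin ?(ltW C0)//.
split; first by apply/seteqP; split=> f; exact: sub.
have [C [C0 XY]] := le X Y; have [C' [C'0 YX]] := le Y X.
(* The lower constant inverts the bound of the norm [X] by the norm [Y]. *)
exists C^-1, C'; split; rewrite ?invr_gt0// => f.
rewrite hardy_spaceE => -[fM _]; split; last exact: YX.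
by rewrite lee_pdivrMl// XY.
Qed.
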